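(* Let $\Gamma$ be a global context all of whose rewrite rules satisfy the encoding conditions. The congruence generated by $\to_{\beta\Gamma\beta}$ is equal to $\equiv_{\beta\Gamma}$.
   Context: $\lambda\Pi$-terms (untyped): objects $t ::= x \mid c \mid t\,t \mid \lambda x:U.t$; types $U,V ::= C \mid U\,t \mid \lambda x:U.V \mid \Pi x:U.V$; kinds $K ::= \mathrm{Type}\mid\Pi x:U.K$; a term is an object, type, kind or $\mathrm{Kind}$. A global context contains declarations and rewrite rules $(u\to v)$ (pairs of objects or of types). $\to_\beta$: least relation containing $(\lambda x:A.u)v\to u[x/v]$, closed under subterms; $\to_\Gamma$: least relation containing the rules of $\Gamma$, closed under arbitrary substitution and subterms; $\equiv_{\beta\Gamma}$: the congruence (reflexive–symmetric–transitive closure) generated by $\to_\beta\cup\to_\Gamma$. HRS: simple types over base type $\mathtt{term}$; $\mathtt{term}^1=\mathtt{term}$, $\mathtt{term}^{n+1}=\mathtt{term}\to\mathtt{term}^n$. Signature: $\mathtt{Type},\mathtt{Kind}:\mathtt{term}$, $\mathtt{app}:\mathtt{term}\to\mathtt{term}\to\mathtt{term}$, $\mathtt{lam},\mathtt{pi}:\mathtt{term}\to(\mathtt{term}\to\mathtt{term})\to\mathtt{term}$, $\mathtt{c}:\mathtt{term}$ per constant $c$. HRS-terms: simply typed $\lambda$-terms ($t(u)$, $\underline\lambda x.t$) in long $\beta\eta$-normal form; $\Downarrow t$ long $\beta\eta$-normal form. Pattern: every free occurrence of a variable $F$ is in a subterm $F(u_1,\dots,u_n)$ with the $u_i$ $\eta$-equivalent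 to distinct bound variables. HRS rule $(l\to r)$: same base type, $l$ a pattern not $\eta$-equivalent to a variable, $FV(r)\subseteq FV(l)$. $\to_R$: least relation closed under subterms with $\Downarrow\sigma(l)\to_R\Downarrow\sigma(r)$ for each rule and well-typed substitution $\sigma$. Encoding $[\![\cdot]\!]$: $[\![\mathrm{Kind}]\!]=\mathtt{Kind}$, $[\![\mathrm{Type}]\!]=\mathtt{Type}$, $[\![x]\!]=x:\mathtt{term}$, $[\![c]\!]=\mathtt{c}$, $[\![uv]\!]=\mathtt{app}([\![u]\!],[\![v]\!])$, $[\![\lambda x:A.t]\!]=\mathtt{lam}([\![A]\!],\underline\lambda x.[\![t]\!])$, $[\![\Pi x:A.B]\!]=\mathtt{pi}([\![A]\!],\underline\lambda x.[\![B]\!])$. For $t$ uniform in $V$ (all occurrences of each free variable of $t$ not in $V$ applied to the same number of arguments), $[\![t]\!]_V$: identical on sorts and constants, $[\![x]\!]_V=x$ if $x\in V$, $[\![\lambda x:A.u]\!]_V=\mathtt{lam}([\![A]\!]_V,\underline\lambda x.[\![u]\!]_{V\cup\{x\}})$, $[\![\Pi x:A.B]\!]_V=\mathtt{pi}([\![A]\!]_V,\underline\lambda x.[\![B]\!]_{V\cup\{x\}})$, $[\![x\,v_1\dots v_n]\!]_V=x([\![v_1]\!]_V,\dots,[\![v_n]\!]_V)$ for $x\notin V$ ($x:\mathtt{term}^{n+1}$), $[\![uv]\!]_V=\mathtt{app}([\![u]\!]_V,[\![v]\!]_V)$ otherwise. $\lambda\Pi$-patterns: for $V=(V_0,\mathcal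 A)$ ($\mathcal A$ arity function), $\mathcal P_V$ is least with: constants; $pq$ for $p,q\in\mathcal P_V$; $x\in V_0$; $p\,(x\vec y)$ for $p\in\mathcal P_V$, $x\notin V_0$, $\vec y$ pairwise distinct in $V_0$ with $|\vec y|=\mathcal A(x)$; $p\,(\lambda x:A.q)$ for $p\in\mathcal P_V$, $FV(A)\subseteq V_0$, $q\in\mathcal P_{(V_0\cup\{x\},\mathcal A)}$. A $\lambda\Pi$-pattern is an element of some $\mathcal P_{(\emptyset,\mathcal A)}$. Encoding conditions on $(u\to v)$: $u$ a $\lambda\Pi$-pattern, $FV(v)\subseteq FV(u)$, every free variable applied to the same number of arguments at all its occurrences in $u$ and $v$; $[\![u\to v]\!]=([\![u]\!]_\emptyset\to[\![v]\!]_\emptyset)$. $\mathrm{HRS}(\beta\Gamma)=\{[\![u\to v]\!]:(u\to v)\in\Gamma\}\cup\{\mathtt{app}(\mathtt{lam}(X,\underline\lambda x.Y(x)),Z)\to Y(Z)\}$. $t_1\to_{\beta\Gamma\beta}t_2$ iff $[\![t_1]\!]\to_{\mathrm{HRS}(\beta\Gamma)}[\![t_2]\!]$. *)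

(* Defs.v *)
From Stdlib Require Import List Arith Bool Relations Lia.
Import ListNotations.

Set Implicit Arguments.

(* Both calculi use de Bruijn indices.  A term lives in an infinite supply of
   free variables: under k binders the indices below k are bound and index
   k + x is the free variable x.  Terms are thereby identified up to
   alpha-conversion.  Sets of variables, arity functions, typing contexts and
   substitutions are all functions on indices, and scons extends any of them
   when a binder is crossed. *)
Definition scons {X : Type} (a : X) (f : nat -> X) (x : nat) : X :=
  match x with 0 => a | S y => f y end.

Definition upren (xi : nat -> nat) : nat -> nat :=
  scons 0 (fun x => S (xi x)).

Section LambdaPi.

Variables oc tc : Type.

Inductive obj : Type :=
| Var (x : nat)
| Cst (c : oc)
| App (t u : obj)
| Lam (U : ty) (t : obj)
with ty : Type :=
| TCst (C : tc)
| TApp (U : ty) (t : obj)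
| TLam (U V : ty)
| TPi (U V : ty).

Inductive kind : Type :=
| KType
| KPi (U : ty) (K : kind).

Inductive term : Type :=
| TmObj (t : obj)
| TmTy (U : ty)
| TmKind (K : kind)
| TmKIND.

Fixpoint oren (xi : nat -> nat) (t : obj) : obj :=
  match t with
  | Var x => Var (xi x)
  | Cst c => Cst c
  | App t u => App (oren xi t) (oren xi u)
  | Lam U t => Lam (tren xi U) (oren (upren xi) t)
  end
with tren (xi : nat -> nat) (U : ty) : ty :=
  match U with
  | TCst C => TCst C
  | TApp U t => TApp (tren xi U) (oren xi t)
  | TLam U V => TLam (tren xi U) (tren (upren xi) V)
  | TPi U V => TPi (tren xi U) (tren (upren xi) V)
  end.

Definition oup (s : nat -> obj) : nat -> obj :=
  scons (Var 0) (fun x => oren S (s x)).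

Fixpoint osubst (s : nat -> obj) (t : obj) : obj :=
  match t with
  | Var x => s x
  | Cst c => Cst c
  | App t u => App (osubst s t) (osubst s u)
  | Lam U t => Lam (tsubst s U) (osubst (oup s) t)
  end
with tsubst (s : nat -> obj) (U : ty) : ty :=
  match U with
  | TCst C => TCst C
  | TApp U t => TApp (tsubst s U) (osubst s t)
  | TLam U V => TLam (tsubst s U) (tsubst (oup s) V)
  | TPi U V => TPi (tsubst s U) (tsubst (oup s) V)
  end.

Section Closure.

Variables (Ro : obj -> obj -> Prop) (Rt : ty -> ty -> Prop).

Inductive ostep : obj -> obj -> Prop :=
| ostep_root t t' : Ro t t' -> ostep t t'
| ostep_appl t t' u : ostep t t' -> ostep (App t u) (App t' u)
| ostep_appr t u u' : ostep u u' -> ostep (App t u) (App t u')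
| ostep_laml U U' t : tstep U U' -> ostep (Lam U t) (Lam U' t)
| ostep_lamr U t t' : ostep t t' -> ostep (Lam U t) (Lam U t')
with tstep : ty -> ty -> Prop :=
| tstep_root U U' : Rt U U' -> tstep U U'
| tstep_appl U U' t : tstep U U' -> tstep (TApp U t) (TApp U' t)
| tstep_appr U t t' : ostep t t' -> tstep (TApp U t) (TApp U t')
| tstep_laml U U' V : tstep U U' -> tstep (TLam U V) (TLam U' V)
| tstep_lamr U V V' : tstep V V' -> tstep (TLam U V) (TLam U V')
| tstep_pil U U' V : tstep U U' -> tstep (TPi U V) (TPi U' V)
| tstep_pir U V V' : tstep V V' -> tstep (TPi U V) (TPi U V').

Inductive kstep : kind -> kind -> Prop :=
| kstep_pil U U' K : tstep U U' -> kstep (KPi U K) (KPi U' K)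
| kstep_pir U K K' : kstep K K' -> kstep (KPi U K) (KPi U K').

Inductive step : term -> term -> Prop :=
| step_obj t t' : ostep t t' -> step (TmObj t) (TmObj t')
| step_ty U U' : tstep U U' -> step (TmTy U) (TmTy U')
| step_kind K K' : kstep K K' -> step (TmKind K) (TmKind K').

End Closure.

Inductive obeta : obj -> obj -> Prop :=
| obeta_intro U t v : obeta (App (Lam U t) v) (osubst (scons v Var) t).

Inductive tbeta : ty -> ty -> Prop :=
| tbeta_intro U V v : tbeta (TApp (TLam U V) v) (tsubst (scons v Var) V).

Definition beta : term -> term -> Prop := step obeta tbeta.

Inductive entry : Type :=
| DeclObj (c : oc) (U : ty)
| DeclTy (C : tc) (K : kind)
| RuleObj (u v : obj)
| RuleTy (u v : ty).

Definition gctx : Type := list entry.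

Inductive orule (G : gctx) : obj -> obj -> Prop :=
| orule_intro u v s :
    In (RuleObj u v) G -> orule G (osubst s u) (osubst s v).

Inductive trule (G : gctx) : ty -> ty -> Prop :=
| trule_intro u v s :
    In (RuleTy u v) G -> trule G (tsubst s u) (tsubst s v).

Definition gamma (G : gctx) : term -> term -> Prop :=
  step (orule G) (trule G).

Definition conv_beta_gamma (G : gctx) : term -> term -> Prop :=
  clos_refl_sym_trans term (fun t u => beta t u \/ gamma G t u).

(* Free occurrences: (x, n) is listed for each occurrence of the free variable
   x as the head of a maximal application x v_1 ... v_n.  The argument k is
   the number of binders crossed, n the number of arguments to which the
   current subterm is applied. *)
Fixpoint oocc (k n : nat) (t : obj) : list (nat * nat) :=
  match t with
  | Var x => if k <=? x then [(x - k, n)] else []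
  | Cst _ => []
  | App t u => oocc k (S n) t ++ oocc k 0 u
  | Lam U t => tocc k U ++ oocc (S k) 0 t
  end
with tocc (k : nat) (U : ty) : list (nat * nat) :=
  match U with
  | TCst _ => []
  | TApp U t => tocc k U ++ oocc k 0 t
  | TLam U V => tocc k U ++ tocc (S k) V
  | TPi U V => tocc k U ++ tocc (S k) V
  end.

Definition ofv (t : obj) : list nat := map fst (oocc 0 0 t).
Definition tfv (U : ty) : list nat := map fst (tocc 0 U).

Definition uniform (l : list (nat * nat)) : Prop :=
  forall x n m, In (x, n) l -> In (x, m) l -> n = m.

Fixpoint apps (t : obj) (us : list obj) : obj :=
  match us with [] => t | u :: us => apps (App t u) us end.

(* opat V A and tpat V A are the objects and types in P_(V, A), and parg V A
   lists the possible arguments of a pattern: a pattern, a free variable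
   applied to distinct variables of V, or an abstraction of a pattern. *)
Inductive opat : (nat -> bool) -> (nat -> nat) -> obj -> Prop :=
| opat_cst V A c : opat V A (Cst c)
| opat_var V A x : V x = true -> opat V A (Var x)
| opat_app V A p a : opat V A p -> parg V A a -> opat V A (App p a)
with parg : (nat -> bool) -> (nat -> nat) -> obj -> Prop :=
| parg_pat V A q : opat V A q -> parg V A q
| parg_free V A x ys :
    V x = false -> NoDup ys -> Forall (fun y => V y = true) ys ->
    length ys = A x -> parg V A (apps (Var x) (map Var ys))
| parg_lam V A U q :
    (forall x, In x (tfv U) -> V x = true) ->
    opat (scons true V) (scons 0 A) q -> parg V A (Lam U q).

Inductive tpat : (nat -> bool) -> (nat -> nat) -> ty -> Prop :=
| tpat_cst V A C : tpat V A (TCst C)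
| tpat_app V A p a : tpat V A p -> parg V A a -> tpat V A (TApp p a).

Definition vempty : nat -> bool := fun _ => false.

Definition encodable (e : entry) : Prop :=
  match e with
  | RuleObj u v =>
      (exists A, opat vempty A u) /\
      incl (ofv v) (ofv u) /\
      uniform (oocc 0 0 u ++ oocc 0 0 v)
  | RuleTy u v =>
      (exists A, tpat vempty A u) /\
      incl (tfv v) (tfv u) /\
      uniform (tocc 0 u ++ tocc 0 v)
  | DeclObj _ _ | DeclTy _ _ => True
  end.

End LambdaPi.

Arguments Var {oc tc}.
Arguments Cst {oc tc}.
Arguments TCst {oc tc}.
Arguments KType {oc tc}.
Arguments TmKIND {oc tc}.

Section HRS.

Inductive sty : Type :=
| base
| arr (a b : sty).

(* The signature: constants with their simple types. *)
Variables (sym : Type) (sym_ty : sym -> sty).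

Inductive htm : Type :=
| HVar (x : nat)
| HCst (c : sym)
| HApp (t u : htm)
| HLam (t : htm).

Definition ctx : Type := nat -> sty.

Fixpoint hren (xi : nat -> nat) (t : htm) : htm :=
  match t with
  | HVar x => HVar (xi x)
  | HCst c => HCst c
  | HApp t u => HApp (hren xi t) (hren xi u)
  | HLam t => HLam (hren (upren xi) t)
  end.

Definition hup (s : nat -> htm) : nat -> htm :=
  scons (HVar 0) (fun x => hren S (s x)).

Fixpoint hsubst (s : nat -> htm) (t : htm) : htm :=
  match t with
  | HVar x => s x
  | HCst c => HCst c
  | HApp t u => HApp (hsubst s t) (hsubst s u)
  | HLam t => HLam (hsubst (hup s) t)
  end.

Inductive has_type : ctx -> sty -> htm -> Prop :=
| ht_var D x : has_type D (D x) (HVar x)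
| ht_cst D c : has_type D (sym_ty c) (HCst c)
| ht_app D a b t u :
    has_type D (arr a b) t -> has_type D a u -> has_type D b (HApp t u)
| ht_lam D a b t :
    has_type (scons a D) b t -> has_type D (arr a b) (HLam t).

Inductive hbeta : htm -> htm -> Prop :=
| hbeta_intro t u : hbeta (HApp (HLam t) u) (hsubst (scons u HVar) t).

Inductive heta : htm -> htm -> Prop :=
| heta_intro t : heta (HLam (HApp (hren S t) (HVar 0))) t.

Inductive hcompat (R : htm -> htm -> Prop) : htm -> htm -> Prop :=
| hc_root t t' : R t t' -> hcompat R t t'
| hc_appl t t' u : hcompat R t t' -> hcompat R (HApp t u) (HApp t' u)
| hc_appr t u u' : hcompat R u u' -> hcompat R (HApp t u) (HApp t u')
| hc_lam t t' : hcompat R t t' -> hcompat R (HLam t) (HLam t').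

Definition eta_eq : htm -> htm -> Prop :=
  clos_refl_sym_trans htm (hcompat heta).

Definition betaeta_eq : htm -> htm -> Prop :=
  clos_refl_sym_trans htm (hcompat (fun t u => hbeta t u \/ heta t u)).

(* lnf D a t: t is an HRS-term of type a, that is, a simply typed term in long
   beta-eta-normal form; neu is the auxiliary notion of a variable or constant
   applied to HRS-terms, possibly not yet to all its arguments. *)
Inductive lnf : ctx -> sty -> htm -> Prop :=
| lnf_lam D a b t : lnf (scons a D) b t -> lnf D (arr a b) (HLam t)
| lnf_neu D t : neu D base t -> lnf D base t
with neu : ctx -> sty -> htm -> Prop :=
| neu_var D x : neu D (D x) (HVar x)
| neu_cst D c : neu D (sym_ty c) (HCst c)
| neu_app D a b t u : neu D (arr a b) t -> lnf D a u -> neu D b (HApp t u).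

(* The graph of the long beta-eta-normal form at type a. *)
Definition lnf_of (D : ctx) (a : sty) (t t' : htm) : Prop :=
  has_type D a t /\ betaeta_eq t t' /\ lnf D a t'.

Fixpoint hfree (x : nat) (t : htm) : Prop :=
  match t with
  | HVar y => x = y
  | HCst _ => False
  | HApp t u => hfree x t \/ hfree x u
  | HLam t => hfree (S x) t
  end.

Fixpoint happs (t : htm) (us : list htm) : htm :=
  match us with [] => t | u :: us => happs (HApp t u) us end.

(* hpattern k t: under k binders, t is a pattern. *)
Inductive hpattern : nat -> htm -> Prop :=
| hpat_free k x us ys :
    k <= x -> Forall2 (fun u y => eta_eq u (HVar y)) us ys ->
    NoDup ys -> Forall (fun y => y < k) ys -> hpattern k (happs (HVar x) us)
| hpat_bound k x us :
    x < k -> Forall (hpattern k) us -> hpattern k (happs (HVar x) us)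
| hpat_cst k c us :
    Forall (hpattern k) us -> hpattern k (happs (HCst c) us)
| hpat_lam k t : hpattern (S k) t -> hpattern k (HLam t).

(* A pair (lhs, rhs) together with the types of its free variables. *)
Record hrule : Type := HRule { hctx : ctx; hlhs : htm; hrhs : htm }.

Definition hrule_wf (r : hrule) : Prop :=
  lnf (hctx r) base (hlhs r) /\
  lnf (hctx r) base (hrhs r) /\
  hpattern 0 (hlhs r) /\
  (forall x, ~ eta_eq (hlhs r) (HVar x)) /\
  (forall x, hfree x (hrhs r) -> hfree x (hlhs r)).

(* hstep R D a is the rewrite relation of R on the HRS-terms of type a. *)
Inductive hstep (R : hrule -> Prop) : ctx -> sty -> htm -> htm -> Prop :=
| hstep_root r D s t t' :
    R r ->
    (forall x, lnf D (hctx r x) (s x)) ->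
    lnf_of D base (hsubst s (hlhs r)) t ->
    lnf_of D base (hsubst s (hrhs r)) t' ->
    hstep R D base t t'
| hstep_lam D a b t t' :
    hstep R (scons a D) b t t' -> hstep R D (arr a b) (HLam t) (HLam t')
| hstep_appl D a b t t' u :
    neu D (arr a b) t -> lnf D a u ->
    hstep R D (arr a b) t t' -> hstep R D b (HApp t u) (HApp t' u)
| hstep_appr D a b t u u' :
    neu D (arr a b) t ->
    hstep R D a u u' -> hstep R D b (HApp t u) (HApp t u').

End HRS.

Arguments HVar {sym}.

Section Encoding.

Variables oc tc : Type.

(* tpow n is the type written term^(n+1): n arguments. *)
Fixpoint tpow (n : nat) : sty :=
  match n with 0 => base | S n => arr base (tpow n) end.

Inductive esym : Type :=
| SType
| SKind
| SApp
| SLam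
| SPi
| SObj (c : oc)
| STy (C : tc).

Definition esym_ty (c : esym) : sty :=
  match c with
  | SApp => arr base (arr base base)
  | SLam | SPi => arr base (arr (arr base base) base)
  | SType | SKind | SObj _ | STy _ => base
  end.

Definition etm : Type := htm esym.

Definition happ (t u : etm) : etm := HApp (HApp (HCst SApp) t) u.
Definition hlam (U t : etm) : etm := HApp (HApp (HCst SLam) U) (HLam t).
Definition hpi (U V : etm) : etm := HApp (HApp (HCst SPi) U) (HLam V).

Fixpoint oenc (t : obj oc tc) : etm :=
  match t with
  | Var x => HVar x
  | Cst c => HCst (SObj c)
  | App t u => happ (oenc t) (oenc u)
  | Lam U t => hlam (tenc U) (oenc t)
  end
with tenc (U : ty oc tc) : etm :=
  match U with
  | TCst C => HCst (STy C)
  | TApp U t => happ (tenc U) (oenc t)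
  | TLam U V => hlam (tenc U) (tenc V)
  | TPi U V => hpi (tenc U) (tenc V)
  end.

Fixpoint kenc (K : kind oc tc) : etm :=
  match K with
  | KType => HCst SType
  | KPi U K => hpi (tenc U) (kenc K)
  end.

Definition enc (t : term oc tc) : etm :=
  match t with
  | TmObj t => oenc t
  | TmTy U => tenc U
  | TmKind K => kenc K
  | TmKIND => HCst SKind
  end.

(* t is x v_1 ... v_n with x outside V. *)
Fixpoint flex (V : nat -> bool) (t : obj oc tc) : bool :=
  match t with
  | Var x => negb (V x)
  | App t _ => flex V t
  | Cst _ | Lam _ _ => false
  end.

(* The application x v_1 ... v_n of a variable x outside V becomes the
   application of x in the target language, built one argument at a time. *)
Fixpoint oencV (V : nat -> bool) (t : obj oc tc) : etm :=
  match t with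
  | Var x => HVar x
  | Cst c => HCst (SObj c)
  | App t u =>
      if flex V t then HApp (oencV V t) (oencV V u)
      else happ (oencV V t) (oencV V u)
  | Lam U t => hlam (tencV V U) (oencV (scons true V) t)
  end
with tencV (V : nat -> bool) (U : ty oc tc) : etm :=
  match U with
  | TCst C => HCst (STy C)
  | TApp U t => happ (tencV V U) (oencV V t)
  | TLam U W => hlam (tencV V U) (tencV (scons true V) W)
  | TPi U W => hpi (tencV V U) (tencV (scons true V) W)
  end.

(* The number of arguments of x given by a list of occurrences.  It is only
   used for the occurrences in a left-hand side, which are uniform; variables
   that do not occur get the dummy value 0. *)
Definition arity (l : list (nat * nat)) (x : nat) : nat :=
  match find (fun p => fst p =? x) l with Some p => snd p | None => 0 end.

Definition enc_orule (u v : obj oc tc) : hrule esym :=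
  HRule (fun x => tpow (arity (oocc 0 0 u) x)) (oencV vempty u) (oencV vempty v).

Definition enc_trule (u v : ty oc tc) : hrule esym :=
  HRule (fun x => tpow (arity (tocc 0 u) x)) (tencV vempty u) (tencV vempty v).

(* X, Y, Z are the variables 0, 1, 2; Y has index 2 below the binder. *)
Definition beta_rule : hrule esym :=
  HRule (scons base (scons (arr base base) (fun _ => base)))
    (happ (hlam (HVar 0) (HApp (HVar 2) (HVar 0))) (HVar 2))
    (HApp (HVar 1) (HVar 2)).

Inductive HRS_beta_gamma (G : gctx oc tc) : hrule esym -> Prop :=
| HRS_beta : HRS_beta_gamma G beta_rule
| HRS_obj u v : In (RuleObj u v) G -> HRS_beta_gamma G (enc_orule u v)
| HRS_ty u v : In (RuleTy u v) G -> HRS_beta_gamma G (enc_trule u v).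

Definition beta_gamma_beta (G : gctx oc tc) (t1 t2 : term oc tc) : Prop :=
  hstep esym_ty (HRS_beta_gamma G) (fun _ => base) base (enc t1) (enc t2).

Definition conv_beta_gamma_beta (G : gctx oc tc) : term oc tc -> term oc tc -> Prop :=
  clos_refl_sym_trans (term oc tc) (beta_gamma_beta G).

End Encoding.

Section WellFormed.

Variables oc tc : Type.
Scheme obj_mut_ind := Induction for obj Sort Prop
with ty_mut_ind := Induction for ty Sort Prop.
Combined Scheme obj_ty_ind from obj_mut_ind, ty_mut_ind.

Lemma occ_under :
  (forall (t : obj oc tc) k m x n, In (x, n) (oocc (S k) m t) <-> In (S x, n) (oocc k m t)) /\
  (forall (U : ty oc tc) k x n, In (x, n) (tocc (S k) U) <-> In (S x, n) (tocc k U)).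
Proof.
apply (@obj_ty_ind oc tc
 (fun t => forall k m x n, In (x, n) (oocc (S k) m t) <-> In (S x, n) (oocc k m t))
 (fun U => forall k x n, In (x, n) (tocc (S k) U) <-> In (S x, n) (tocc k U)));
 simpl; intros; try tauto; rewrite ?in_app_iff; try (rewrite H, H0; tauto).
- destruct x as [|y]; simpl.
  + destruct k; simpl; try tauto. intuition congruence.
  + destruct (Nat.leb_spec k y); destruct (Nat.leb_spec k (S y)); try lia;
    try (assert (k = S y) by lia; subst);
    replace (y - (S y)) with 0 by lia;
    try (replace (S y - k) with (S (y - k)) by lia); simpl;
    split; intros; repeat match goal with
     | H : _ \/ _ |- _ => destruct H | H : (_,_) = (_,_) |- _ => inversion H; subst; clear H end; try tauto; try lia.
all: left; f_equal; try (destruct k); lia.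
Qed.

Lemma encV_typed :
  (forall (t : obj oc tc) (V : nat -> bool) (D : ctx) m,
    (forall x n, In (x, n) (oocc 0 m t) -> D x = if V x then base else tpow n) ->
    neu (@esym_ty oc tc) D (if flex V t then tpow m else base) (oencV V t)) /\
  (forall (U : ty oc tc) (V : nat -> bool) (D : ctx),
    (forall x n, In (x, n) (tocc 0 U) -> D x = if V x then base else tpow n) ->
    neu (@esym_ty oc tc) D base (tencV V U)).
Proof.
apply (@obj_ty_ind oc tc (fun t => forall (V : nat -> bool) (D : ctx) m,
    (forall x n, In (x, n) (oocc 0 m t) -> D x = if V x then base else tpow n) ->
    neu (@esym_ty oc tc) D (if flex V t then tpow m else base) (oencV V t))
 (fun U => forall (V : nat -> bool) (D : ctx),
    (forall x n, In (x, n) (tocc 0 U) -> D x = if V x then base else tpow n) ->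
    neu (@esym_ty oc tc) D base (tencV V U))); simpl; intros.
- specialize (H x m). rewrite Nat.sub_0_r in H.
  replace (if negb (V x) then tpow m else base) with (D x); [constructor|].
  rewrite H; auto. destruct (V x); reflexivity.
- apply (neu_cst (@esym_ty oc tc) D (SObj tc c)).
- assert (A : neu (@esym_ty oc tc) D (if flex V t then tpow (S m) else base) (oencV V t))
    by (apply H; intros; apply H1; apply in_app_iff; auto).
  assert (B : neu (@esym_ty oc tc) D (if flex V u then tpow 0 else base) (oencV V u))
    by (apply H0; intros; apply H1; apply in_app_iff; auto).
  assert (B' : lnf (@esym_ty oc tc) D base (oencV V u))
    by (constructor; destruct (flex V u); exact B).
  destruct (flex V t).
  + exact (neu_app A B').
  + eapply neu_app; [eapply neu_app; [apply (neu_cst (@esym_ty oc tc) D (@SApp oc tc))|]|]; auto.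
    constructor; auto.
- eapply neu_app; [eapply neu_app; [apply (neu_cst (@esym_ty oc tc) D (@SLam oc tc))|]|].
  + constructor. apply H. intros; apply H1; apply in_app_iff; auto.
  + repeat constructor.
   assert (B : neu (@esym_ty oc tc) (scons base D) (if flex (scons true V) t then tpow 0 else base) (oencV (scons true V) t)).
   { apply H0; intros [|x] n Hx; simpl; auto. apply H1, in_app_iff. right.
     apply occ_under; auto. }
   destruct (flex (scons true V) t); exact B.
- apply (neu_cst (@esym_ty oc tc) D (STy oc C)).
- eapply neu_app; [eapply neu_app; [apply (neu_cst (@esym_ty oc tc) D (@SApp oc tc))|]|].
  + constructor. apply H. intros; apply H1; apply in_app_iff; auto.
  + constructor. assert (B : neu (@esym_ty oc tc) D (if flex V t then tpow 0 else base) (oencV V t))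
    by (apply H0; intros; apply H1; apply in_app_iff; auto).
    destruct (flex V t); exact B.
- eapply neu_app; [eapply neu_app; [apply (neu_cst (@esym_ty oc tc) D (@SLam oc tc))|]|].
  + constructor. apply H. intros; apply H1; apply in_app_iff; auto.
  + repeat constructor. apply H0; intros [|x] n Hx; simpl; auto. apply H1, in_app_iff. right.
     apply occ_under; auto.
- eapply neu_app; [eapply neu_app; [apply (neu_cst (@esym_ty oc tc) D (@SPi oc tc))|]|].
  + constructor. apply H. intros; apply H1; apply in_app_iff; auto.
  + repeat constructor. apply H0; intros [|x] n Hx; simpl; auto. apply H1, in_app_iff. right.
     apply occ_under; auto.
Qed.

Lemma encV_free :
  (forall (t : obj oc tc) V m x, hfree x (oencV V t) <-> exists n, In (x, n) (oocc 0 m t)) /\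
  (forall (U : ty oc tc) V x, hfree x (tencV V U) <-> exists n, In (x, n) (tocc 0 U)).
Proof.
apply (@obj_ty_ind oc tc (fun t => forall V m x, hfree x (oencV V t) <-> exists n, In (x, n) (oocc 0 m t))
  (fun U => forall V x, hfree x (tencV V U) <-> exists n, In (x, n) (tocc 0 U))); simpl; intros;
  try (setoid_rewrite in_app_iff).
- rewrite Nat.sub_0_r. split; [intros ->; eauto|intros [n [E|[]]]; congruence].
- firstorder.
- destruct (flex V t); simpl; rewrite (H V (S m)), (H0 V 0); firstorder.
- rewrite H, (H0 _ 0). setoid_rewrite <- (proj1 occ_under). firstorder.
- firstorder.
- rewrite H, (H0 _ 0). firstorder.
- rewrite H, H0. setoid_rewrite <- (proj2 occ_under). firstorder.
- rewrite H, H0. setoid_rewrite <- (proj2 occ_under). firstorder.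
Qed.

Definition below k (V : nat -> bool) := forall x, V x = (x <? k).
Lemma below_scons k V : below k V -> below (S k) (scons true V).
Proof. intros H [|x]; simpl; auto. Qed.

Lemma hpattern_bin k c t u : hpattern k t -> hpattern k u -> @hpattern (esym oc tc) k (HApp (HApp (HCst c) t) u).
Proof. intros. apply (@hpat_cst _ k c [t; u]). auto. Qed.

Lemma flex_false (t : obj oc tc) (V : nat -> bool) m : (forall x n, In (x, n) (oocc 0 m t) -> V x = true) -> flex V t = false.
Proof.
revert m; induction t; simpl; intros; auto.
- specialize (H x m). rewrite Nat.sub_0_r in H. rewrite H; auto.
- apply (IHt1 (S m)). intros; eapply H, in_app_iff; eauto.
Qed.

Lemma encV_closed_pattern :
  (forall (t : obj oc tc) k (V : nat -> bool) m, below k V -> (forall x n, In (x, n) (oocc 0 m t) -> V x = true) -> hpattern k (oencV V t)) /\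
  (forall (U : ty oc tc) k (V : nat -> bool), below k V -> (forall x n, In (x, n) (tocc 0 U) -> V x = true) -> hpattern k (tencV V U)).
Proof.
apply (@obj_ty_ind oc tc (fun t => forall k (V : nat -> bool) m, below k V -> (forall x n, In (x, n) (oocc 0 m t) -> V x = true) -> hpattern k (oencV V t))
 (fun U => forall k (V : nat -> bool), below k V -> (forall x n, In (x, n) (tocc 0 U) -> V x = true) -> hpattern k (tencV V U)));
 simpl; intros.
1: { apply (@hpat_bound _ k x []); auto. specialize (H0 x m). rewrite Nat.sub_0_r, H in H0. apply Nat.ltb_lt; auto. }
1: { apply (@hpat_cst _ k _ []); auto. }
1: { rewrite ((flex_false t V (S m))). 2: intros; eapply H2, in_app_iff; eauto.
  apply hpattern_bin; [apply (H _ _ (S m)) | apply (H0 _ _ 0)]; auto; intros; eapply H2, in_app_iff; eauto. }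
2: { apply (@hpat_cst _ k _ []); auto. }
2: { apply hpattern_bin; [apply H | apply (H0 _ _ 0)]; auto; intros; eapply H2, in_app_iff; eauto. }
all: apply hpattern_bin; [apply H; auto; intros; eapply H2, in_app_iff; eauto |].
all: apply hpat_lam; try apply (H0 _ _ 0); try apply H0; auto using below_scons;
 intros [|x] n Hx; simpl; auto; eapply H2, in_app_iff; right; apply occ_under; eauto.
Qed.

Scheme opat_mut_ind := Induction for opat Sort Prop
with parg_mut_ind := Induction for parg Sort Prop.
Combined Scheme opat_parg_ind from opat_mut_ind, parg_mut_ind.

Lemma opat_flex V A (t : obj oc tc) : opat V A t -> flex V t = false.
Proof.
induction t; simpl; intros H; inversion H; subst; auto. rewrite H3; auto.
Qed.

Lemma encV_apps V (ys : list (obj oc tc)) t : flex V t = true -> oencV V (apps t ys) = happs (oencV V t) (map (oencV V) ys).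
Proof.
revert t; induction ys; simpl; intros; auto. rewrite IHys; simpl; rewrite H; auto.
Qed.

Lemma opat_encV :
  (forall V A (t : obj oc tc), opat V A t -> forall k, below k V -> hpattern k (oencV V t)) /\
  (forall V A (t : obj oc tc), parg V A t -> forall k, below k V -> hpattern k (oencV V t)).
Proof.
apply (@opat_parg_ind oc tc (fun V A t _ => forall k, below k V -> hpattern k (oencV V t))
 (fun V A t _ => forall k, below k V -> hpattern k (oencV V t))); simpl; intros; auto.
- apply (@hpat_cst _ k _ []); auto.
- apply (@hpat_bound _ k x []); auto. rewrite H in e. apply Nat.ltb_lt; auto.
- rewrite (opat_flex o). apply hpattern_bin; auto.
- rewrite encV_apps by (simpl; rewrite e; auto). simpl.
  apply hpat_free with (ys := ys); auto.
  + rewrite H in e. apply Nat.ltb_ge; auto.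
  + clear. induction ys; simpl; constructor; auto. apply rst_refl.
  + eapply Forall_impl; eauto. simpl. intros y. rewrite H. apply Nat.ltb_lt.
- apply hpattern_bin.
  + apply encV_closed_pattern; auto. intros. apply e. apply in_map_iff. exists (x, n). auto.
  + apply hpat_lam. apply H; auto using below_scons.
Qed.

Lemma tpat_encV V A (U : ty oc tc) : tpat V A U -> forall k, below k V -> hpattern k (tencV V U).
Proof.
induction 1; simpl; intros.
- apply (@hpat_cst _ k _ []); auto.
- apply hpattern_bin; auto. eapply (proj2 opat_encV); eauto.
Qed.

Fixpoint head_sym (t : htm (esym oc tc)) := match t with HVar _ => None | HCst c => Some c | HApp t _ => head_sym t | HLam t => head_sym t end.
Lemma head_sym_ren t xi : head_sym (hren xi t) = head_sym t.
Proof. revert xi; induction t; simpl; auto. Qed.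
Lemma head_sym_eta t u : eta_eq t u -> head_sym t = head_sym u.
Proof.
induction 1; try congruence. induction H; simpl; auto. destruct H; simpl. apply head_sym_ren.
Qed.

Lemma arity_In (l : list (nat*nat)) x : In x (map fst l) -> In (x, arity l x) l.
Proof.
unfold arity; intros H. destruct (find (fun p => fst p =? x) l) eqn:E.
- destruct (find_some _ _ E). apply Nat.eqb_eq in H1. destruct p; simpl in *; subst; auto.
- apply in_map_iff in H as [p [<- H]]. generalize (find_none _ _ E _ H). rewrite Nat.eqb_refl. discriminate.
Qed.

(* hstep does not itself require its rules to satisfy the conditions on HRS
   rules; this shows that the rules it is used with do. *)
Theorem HRS_beta_gamma_wf (G : gctx oc tc) : (forall e, In e G -> encodable e) -> forall r, HRS_beta_gamma G r -> hrule_wf (@esym_ty oc tc) r.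
Proof.
intros HG r Hr. destruct Hr as [|u v Hr|u v Hr].
- split; [|split; [|split; [|split]]].
  + assert (N : forall x, x = 0 \/ x = 2 -> lnf (@esym_ty oc tc) (hctx (beta_rule oc tc)) base (HVar x)).
    { intros x [->| ->]; constructor; [apply (neu_var _ (hctx (beta_rule oc tc)) 0)|apply (neu_var _ (hctx (beta_rule oc tc)) 2)]. }
    constructor. eapply neu_app; [eapply neu_app; [apply (neu_cst (@esym_ty oc tc) _ (@SApp oc tc))|]|auto].
    constructor. eapply neu_app; [eapply neu_app; [apply (neu_cst (@esym_ty oc tc) _ (@SLam oc tc))|auto]|].
    constructor. constructor. eapply neu_app with (a := base).
    apply (neu_var _ (scons base (hctx (beta_rule oc tc))) 2).
    constructor. apply (neu_var _ (scons base (hctx (beta_rule oc tc))) 0).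
  + constructor. eapply neu_app with (a := base).
    apply (neu_var _ (hctx (beta_rule oc tc)) 1).
    constructor. apply (neu_var _ (hctx (beta_rule oc tc)) 2).
  + assert (P : forall x, @hpattern (esym oc tc) 0 (HVar x)).
    { intros. apply (@hpat_free _ 0 x [] []); auto; try lia; constructor. }
    apply hpattern_bin; auto. apply hpattern_bin; auto. apply hpat_lam.
    apply (@hpat_free _ 1 2 [HVar 0] [0]); auto.
    * constructor; [apply rst_refl|constructor].
    * repeat constructor; simpl; tauto.
  + intros x E. apply head_sym_eta in E. discriminate.
  + simpl. intuition lia.
- destruct (HG _ Hr) as [[A PA] [FV UN]].
  assert (HD : forall x n, In (x,n) (oocc 0 0 u ++ oocc 0 0 v) -> hctx (enc_orule u v) x = if vempty x then base else tpow n).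
  { simpl. intros x n Hx. f_equal. apply (UN x); auto. apply in_app_iff; left. apply arity_In.
    apply in_app_iff in Hx as [Hx|Hx]; [|apply FV]; apply in_map_iff; exists (x,n); auto. }
  assert (TY : forall t, incl (oocc 0 0 t) (oocc 0 0 u ++ oocc 0 0 v) -> lnf (@esym_ty oc tc) (hctx (enc_orule u v)) base (oencV vempty t)).
  { intros t Ht. constructor.
    assert (B := proj1 encV_typed t vempty (hctx (enc_orule u v)) 0 (fun x n Hx => HD x n (Ht _ Hx))).
    destruct (flex vempty t); exact B. }
  split; [|split; [|split; [|split]]].
  + apply TY, incl_appl, incl_refl.
  + apply TY, incl_appr, incl_refl.
  + simpl. eapply (proj1 opat_encV); eauto. intros x; reflexivity.
  + intros x E. apply head_sym_eta in E. simpl in E.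
    assert (F : forall V (t : obj oc tc), opat V A t -> V = vempty -> head_sym (oencV V t) <> None).
    { induction t; intros HH EV; inversion HH; subst; simpl; try discriminate.
      match goal with H : opat _ _ _, H' : parg _ _ _ |- _ => rewrite (opat_flex H) end; discriminate. }
    apply (F _ _ PA); auto.
  + simpl. intros x. rewrite !(proj1 encV_free _ _ 0). intros [n Hn].
    assert (In x (ofv u)) by (apply FV, in_map_iff; exists (x,n); auto).
    apply in_map_iff in H as [[y m] [E H]]. simpl in E; subst; eauto.
- destruct (HG _ Hr) as [[A PA] [FV UN]].
  assert (HD : forall x n, In (x,n) (tocc 0 u ++ tocc 0 v) -> hctx (enc_trule u v) x = if vempty x then base else tpow n).
  { simpl. intros x n Hx. f_equal. apply (UN x); auto. apply in_app_iff; left. apply arity_In.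
    apply in_app_iff in Hx as [Hx|Hx]; [|apply FV]; apply in_map_iff; exists (x,n); auto. }
  split; [|split; [|split; [|split]]].
  + constructor. apply (proj2 encV_typed). intros; apply HD, in_app_iff; auto.
  + constructor. apply (proj2 encV_typed). intros; apply HD, in_app_iff; auto.
  + simpl. eapply tpat_encV; eauto. intros x; reflexivity.
  + intros x E. apply head_sym_eta in E. simpl in E. inversion PA; subst; discriminate.
  + simpl. intros x. rewrite !(proj2 encV_free _ _). intros [n Hn].
    assert (In x (tfv u)) by (apply FV, in_map_iff; exists (x,n); auto).
    apply in_map_iff in H as [[y m] [E H]]. simpl in E; subst; eauto.
Qed.

End WellFormed.

(* Main.v *)
Require Import Defs.
From Stdlib Require Import List Arith Relations Lia.
Import ListNotations.

(** The encoding is injective and turns substitution into substitution, and a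
    beta-step of the calculus is an instance of the HRS rule for beta.  A rule
    instance [sigma u -> sigma v] is an HRS step: if [x] has arity [n], map it
    to the [n]-fold abstraction of [app (... (app [[sigma x]] y_1) ...) y_n].
    Conversely, let an encoding be a root HRS redex for [u -> v] with
    substitution [s].  Since [u] is a pattern, each value [s x] is an [n]-fold
    abstraction over a body that appears, up to a renaming, inside the redex,
    so the body encodes an object [b].  With [sigma x := \y_1 ... y_n. b] both
    sides of the HRS step are beta-equal to [sigma u] and [sigma v] respectively.

    The HRS relation speaks about long normal forms only through untyped
    beta-eta-conversion, so reading off the redex needs their uniqueness.  It
    follows from the Church-Rosser property of untyped beta-eta, because a long
    normal form is determined by its type and any of its eta-reducts. *)

Set Implicit Arguments.

Lemma clos_rst_map (X Y : Type) (R : relation X) (S : relation Y) (f : X -> Y) :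
  (forall x y, R x y -> clos_refl_sym_trans Y S (f x) (f y)) ->
  forall x y, clos_refl_sym_trans X R x y -> clos_refl_sym_trans Y S (f x) (f y).
Proof.
intros H x y E; induction E; eauto using rst_refl, rst_sym, rst_trans.
Qed.

(** * Substitution in the simply typed calculus *)

Section Substitution.

Variable sym : Type.
Implicit Types t u : htm sym.

Lemma hsubst_ext t s r : (forall x, s x = r x) -> hsubst s t = hsubst r t.
Proof.
revert s r; induction t; simpl; intros s r E; f_equal; auto.
apply IHt; intros [|x]; simpl; auto. now rewrite E.
Qed.

Lemma hren_hsubst t xi : hren xi t = hsubst (fun x => HVar (xi x)) t.
Proof.
revert xi; induction t; simpl; intros xi; f_equal; auto.
rewrite IHt; apply hsubst_ext; intros [|x]; reflexivity.
Qed.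

Lemma hsubst_id t s : (forall x, s x = HVar x) -> hsubst s t = t.
Proof.
revert s; induction t; simpl; intros s E; f_equal; auto.
apply IHt; intros [|x]; simpl; auto. now rewrite E.
Qed.

Lemma hsubst_hren t s xi : hsubst s (hren xi t) = hsubst (fun x => s (xi x)) t.
Proof.
revert s xi; induction t; simpl; intros s xi; f_equal; auto.
rewrite IHt; apply hsubst_ext; intros [|x]; reflexivity.
Qed.

Lemma hren_hren t xi zeta : hren zeta (hren xi t) = hren (fun x => zeta (xi x)) t.
Proof. rewrite !(hren_hsubst _ zeta), hsubst_hren, hren_hsubst; reflexivity. Qed.

Lemma hren_upren_S t xi : hren (upren xi) (hren S t) = hren S (hren xi t).
Proof. rewrite !hren_hren; reflexivity. Qed.

Lemma hren_of_hsubst t s xi : hren xi (hsubst s t) = hsubst (fun x => hren xi (s x)) t.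
Proof.
revert s xi; induction t; simpl; intros s xi; f_equal; auto.
rewrite IHt; apply hsubst_ext; intros [|x]; simpl; auto using hren_upren_S.
Qed.

Lemma hsubst_hup_S t s : hsubst (hup s) (hren S t) = hren S (hsubst s t).
Proof. rewrite hsubst_hren, hren_of_hsubst; reflexivity. Qed.

Lemma hsubst_hsubst t s r : hsubst r (hsubst s t) = hsubst (fun x => hsubst r (s x)) t.
Proof.
revert s r; induction t; simpl; intros s r; f_equal; auto.
rewrite IHt; apply hsubst_ext; intros [|x]; simpl; auto using hsubst_hup_S.
Qed.

Lemma hsubst_scons_S t u : hsubst (scons u HVar) (hren S t) = t.
Proof. rewrite hsubst_hren; apply hsubst_id; reflexivity. Qed.

Lemma hsubst_beta t u s :
  hsubst s (hsubst (scons u HVar) t) = hsubst (scons (hsubst s u) HVar) (hsubst (hup s) t).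
Proof.
rewrite !hsubst_hsubst; apply hsubst_ext; intros [|x]; simpl; auto.
now rewrite hsubst_scons_S.
Qed.

Lemma hren_beta t u xi :
  hren xi (hsubst (scons u HVar) t) = hsubst (scons (hren xi u) HVar) (hren (upren xi) t).
Proof.
rewrite hren_of_hsubst, hsubst_hren; apply hsubst_ext; intros [|x]; reflexivity.
Qed.

Lemma hsubst_scons_var t y : hsubst (scons (HVar y) HVar) t = hren (scons y (fun x => x)) t.
Proof. rewrite hren_hsubst; apply hsubst_ext; intros [|x]; reflexivity. Qed.

Lemma hsubst_var0_upren t : hsubst (scons (HVar 0) HVar) (hren (upren S) t) = t.
Proof. rewrite hsubst_hren; apply hsubst_id; intros [|x]; reflexivity. Qed.

Lemma upren_inj xi :
  (forall x y, xi x = xi y -> x = y) -> forall x y, upren xi x = upren xi y -> x = y.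
Proof. intros I [|x] [|y] E; inversion E; auto. Qed.

Lemma hren_inj t u xi : (forall x y, xi x = xi y -> x = y) -> hren xi t = hren xi u -> t = u.
Proof.
revert u xi; induction t; intros [] xi I; simpl; intros E; inversion E; f_equal; eauto.
apply (IHt _ (upren xi)); auto; now apply upren_inj.
Qed.

(** * Church-Rosser for untyped beta-eta *)

(** Parallel reduction in the style of Tait and Martin-Löf, with eta: one step contracts any set of
    redexes already present. This yields a diamond in one step on each side, where single beta and
    eta steps do not. *)
Inductive par : htm sym -> htm sym -> Prop :=
| par_var x : par (HVar x) (HVar x)
| par_cst c : par (HCst c) (HCst c)
| par_app t t' u u' : par t t' -> par u u' -> par (HApp t u) (HApp t' u')
| par_lam t t' : par t t' -> par (HLam t) (HLam t')
| par_beta t t' u u' :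
    par t t' -> par u u' -> par (HApp (HLam t) u) (hsubst (scons u' HVar) t')
| par_eta t t' : par t t' -> par (HLam (HApp (hren S t) (HVar 0))) t'.

Hint Constructors par : core.

Lemma par_refl t : par t t.
Proof. induction t; auto. Qed.
Hint Resolve par_refl : core.

Lemma par_hren t t' xi : par t t' -> par (hren xi t) (hren xi t').
Proof.
intros H; revert xi; induction H; simpl; intros xi; auto.
- rewrite hren_beta; auto.
- rewrite hren_upren_S; auto.
Qed.

Lemma par_hsubst t t' s s' :
  par t t' -> (forall x, par (s x) (s' x)) -> par (hsubst s t) (hsubst s' t').
Proof.
intros H; revert s s'; induction H; simpl; intros s s' E; auto.
- constructor; apply IHpar; intros [|x]; simpl; auto using par_hren.
- rewrite hsubst_beta; constructor; auto.
  apply IHpar1; intros [|x]; simpl; auto using par_hren.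
- rewrite hsubst_hup_S; auto.
Qed.

Lemma par_hsubst1 t t' u u' :
  par t t' -> par u u' -> par (hsubst (scons u HVar) t) (hsubst (scons u' HVar) t').
Proof. intros; apply par_hsubst; auto; intros [|x]; simpl; auto. Qed.

Lemma hren_eq_lam t xi u : hren xi t = HLam u -> exists t0, t = HLam t0 /\ u = hren (upren xi) t0.
Proof. destruct t; simpl; intros E; inversion E; eauto. Qed.

(** For [k = 0] this is the pullback square of [upren xi] along [S]: a term in the image of both
    renamings comes from one term renamed by both. The iterates of [upren] let the induction pass
    under binders. *)
Lemma hren_upren_pullback t u xi k :
  hren (Nat.iter k upren (upren xi)) t = hren (Nat.iter k upren S) u ->
  exists t0, t = hren (Nat.iter k upren S) t0 /\ u = hren (Nat.iter k upren xi) t0.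
Proof.
assert (V : forall k x y, Nat.iter k upren (upren xi) x = Nat.iter k upren S y ->
  exists z, x = Nat.iter k upren S z /\ y = Nat.iter k upren xi z).
{ clear; induction k as [|k IH]; simpl.
  - intros [|x] y; simpl; intros H; inversion H; eauto.
  - intros [|x] [|y]; simpl; intros H; try discriminate.
    + exists 0; auto.
    + injection H as H; destruct (IH _ _ H) as [z [-> ->]]; exists (S z); auto. }
revert u k; induction t; intros [] k E; simpl in E; inversion E.
- destruct (V _ _ _ H0) as [z [-> ->]]; exists (HVar z); auto.
- exists (HCst c0); auto.
- destruct (IHt1 _ _ H0) as [a [-> ->]]; destruct (IHt2 _ _ H1) as [b [-> ->]].
  exists (HApp a b); auto.
- destruct (IHt _ (S k) H0) as [a [-> ->]]; exists (HLam a); auto.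
Qed.

(** Renaming creates no redex. The delicate case is eta: a redex [HLam (HApp (hren S t) (HVar 0))]
    seen after renaming has as preimage a term that already avoids its bound variable, by the
    pullback property. *)
Lemma par_hren_inv t xi w :
  (forall x y, xi x = xi y -> x = y) -> par (hren xi t) w -> exists t', w = hren xi t' /\ par t t'.
Proof.
intros I H; remember (hren xi t) as z eqn:E; revert t xi I E.
induction H; intros [x0|c0|f0 u0|b0] xi I E; simpl in E; inversion E; subst; clear E.
- exists (HVar x0); auto.
- exists (HCst c0); auto.
- destruct (IHpar1 _ xi I eq_refl) as [a [-> A]]; destruct (IHpar2 _ xi I eq_refl) as [b [-> B]].
  exists (HApp a b); auto.
- destruct (IHpar _ _ (upren_inj _ I) eq_refl) as [a [-> A]]; exists (HLam a); auto.
- symmetry in H2; destruct (hren_eq_lam _ _ H2) as [a [-> ->]].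
  destruct (IHpar1 _ _ (upren_inj _ I) eq_refl) as [b [-> B]].
  destruct (IHpar2 _ xi I eq_refl) as [d [-> D]].
  exists (hsubst (scons d HVar) b); split; auto. now rewrite hren_beta.
- destruct b0 as [| |f x|]; simpl in H1; inversion H1; clear H1.
  destruct x as [[|x]| | |]; simpl in H3; inversion H3.
  symmetry in H2; destruct (hren_upren_pullback _ _ _ 0 H2) as [a [-> ->]]; simpl in *.
  destruct (IHpar _ xi I eq_refl) as [b [-> B]]; exists b; auto.
Qed.

Lemma par_shift_inv t w : par (hren S t) w -> exists t', w = hren S t' /\ par t t'.
Proof. apply par_hren_inv; intros; congruence. Qed.

Fixpoint hsize t : nat :=
  match t with
  | HVar _ | HCst _ => 1
  | HApp t u => S (hsize t + hsize u)
  | HLam t => S (hsize t)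
  end.

Lemma hsize_hren t xi : hsize (hren xi t) = hsize t.
Proof. revert xi; induction t; simpl; auto. Qed.

(** The critical pair of beta and eta. The body of an eta-redex keeps its shape, unless [a] is an
    abstraction and the beta-redex [(hren S a) 0] fires; that contraction only undoes the shift, so
    the result is a reduct of the body of [a]. *)
Lemma par_eta_body_inv a b :
  par (HApp (hren S a) (HVar 0)) b ->
  (exists c, b = HApp (hren S c) (HVar 0) /\ par a c) \/
  (exists d, a = HLam d /\ par d b).
Proof.
intros H; inversion H; subst.
- destruct (par_shift_inv _ H2) as [c [-> C]]. inversion H4; subst; eauto.
- right. symmetry in H0; destruct (hren_eq_lam _ _ H0) as [d [-> ->]].
  exists d; split; auto.
  destruct (par_hren_inv _ _ (upren_inj _ eq_add_S) H2) as [d' [-> D]].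
  inversion H4; subst. now rewrite hsubst_var0_upren.
Qed.

(** The induction is on size and not on structure, because an eta-redex contains [hren S t] while
    the argument has to continue at [t], which has the same size but is no subterm. *)
Lemma par_diamond : forall n t, hsize t < n -> forall t1 t2, par t t1 -> par t t2 ->
  exists w, par t1 w /\ par t2 w.
Proof.
induction n as [|n IH]; [lia|]; intros t Hn.
(* Contracting an eta-redex against reducing its body. If the body fires its beta-redex, then
   [HLam b] is itself a reduct of [a], and the induction hypothesis at [a] joins the two sides. *)
assert (EL : forall a b t1, hsize a < n -> par a t1 -> par (HApp (hren S a) (HVar 0)) b ->
  exists w, par t1 w /\ par (HLam b) w).
{ intros a b t1 Ha H1 H2; destruct (par_eta_body_inv _ H2) as [[c [-> C]]|[d [-> D]]].
  - destruct (IH _ Ha _ _ H1 C) as [w [A B]]; eauto.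
  - apply (IH (HLam d)); auto. }
(* Contracting a beta-redex against reducing its two parts. The overlap is critical when the
   abstraction is also an eta-redex. *)
assert (AB : forall f u f' u' b b' u'', f = HLam b -> hsize (HApp f u) <= n ->
  par f f' -> par u u' -> par b b' -> par u u'' ->
  exists w, par (HApp f' u') w /\ par (hsubst (scons u'' HVar) b') w).
{ intros f u f' u' b b' u'' -> Hs Hf Hu Hb Hu'; simpl in Hs.
  destruct (IH u ltac:(lia) _ _ Hu Hu') as [w [W1 W2]].
  inversion Hf; subst.
  - destruct (IH b ltac:(lia) _ _ H0 Hb) as [z [Z1 Z2]].
    exists (hsubst (scons w HVar) z); split; auto using par_hsubst1.
  - simpl in Hs; rewrite hsize_hren in Hs.
    destruct (par_eta_body_inv _ Hb) as [[c [-> C]]|[d [-> D]]].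
    + destruct (IH t0 ltac:(lia) _ _ H0 C) as [z [Z1 Z2]].
      exists (HApp z w); split; auto. simpl; rewrite hsubst_scons_S; auto.
    (* Here the abstraction is the eta-expansion of [HLam d], so both sides are reducts of the
       smaller beta-redex [HApp (HLam d) u]. *)
    + apply (IH (HApp (HLam d) u)); auto. simpl in *; lia. }
intros t1 t2 H1 H2; inversion H1; subst; simpl in Hn.
- inversion H2; subst; eauto.
- inversion H2; subst; eauto.
- inversion H2; subst.
  + destruct (IH t0 ltac:(lia) _ _ H H5) as [a [A1 A2]].
    destruct (IH u ltac:(lia) _ _ H0 H7) as [b [B1 B2]]; eauto.
  + eapply AB; eauto; simpl in *; lia.
- inversion H2; subst.
  + destruct (IH t0 ltac:(lia) _ _ H H3) as [a [A1 A2]]; eauto.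
  + simpl in Hn; rewrite hsize_hren in Hn.
    destruct (EL t t' t2 ltac:(lia) H3 H) as [w [A B]]; eauto.
- inversion H2; subst.
  + destruct (AB (HLam t0) u t'0 u'0 t0 t' u') as [w [A B]]; eauto; simpl; lia.
  + destruct (IH t0 ltac:(lia) _ _ H H5) as [a [A1 A2]].
    destruct (IH u ltac:(lia) _ _ H0 H7) as [b [B1 B2]].
    exists (hsubst (scons b HVar) a); auto using par_hsubst1.
- simpl in Hn; rewrite hsize_hren in Hn; inversion H2; subst.
  + eapply EL; eauto; lia.
  + apply hren_inj in H0; [|intros; congruence]; subst.
    apply (IH t0); auto; lia.
Qed.

Definition pars : relation (htm sym) := clos_refl_trans_1n (htm sym) par.

Lemma par_strip t t1 t2 : par t t1 -> pars t t2 -> exists w, pars t1 w /\ par t2 w.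
Proof.
intros H1 H2; revert t1 H1; induction H2 as [t|t u v H H2 IH]; intros t1 H1.
- exists t1; split; auto; constructor.
- destruct (@par_diamond _ t (le_n _) _ _ H1 H) as [w [A B]].
  destruct (IH _ B) as [z [C D]]; exists z; split; auto.
  econstructor; eauto.
Qed.

Lemma pars_confluent t t1 t2 : pars t t1 -> pars t t2 -> exists w, pars t1 w /\ pars t2 w.
Proof.
intros H1; revert t2; induction H1 as [t|t u v H H1 IH]; intros t2 H2.
- exists t2; split; auto; constructor.
- destruct (par_strip H H2) as [w [A B]]; destruct (IH _ A) as [z [C D]].
  exists z; split; auto; econstructor; eauto.
Qed.

Lemma pars_trans t u v : pars t u -> pars u v -> pars t v.
Proof.
intros H; induction H as [|t w u P H IH]; auto; intros H'.
apply Relation_Operators.rt1n_trans with w; [exact P|exact (IH H')].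
Qed.

Lemma betaeta_eq_joinable t u : betaeta_eq t u -> exists w, pars t w /\ pars u w.
Proof.
induction 1.
- exists y; split; [|constructor]. apply Relation_Operators.rt1n_trans with y; [|constructor].
  induction H; auto. destruct H as [[]|[]]; auto.
- exists x; split; constructor.
- destruct IHclos_refl_sym_trans as [w []]; eauto.
- destruct IHclos_refl_sym_trans1 as [w1 []]; destruct IHclos_refl_sym_trans2 as [w2 []].
  destruct (@pars_confluent y w1 w2) as [v []]; eauto using pars_trans.
Qed.

(** * Uniqueness of long normal forms *)

Variable sym_ty : sym -> sty.

Fixpoint neutral t : Prop :=
  match t with
  | HVar _ | HCst _ => True
  | HApp t _ => neutral t
  | HLam _ => False
  end.

(* [elnf D a t w]: [w] is an eta-reduct of the long normal form [t].  The
   relation determines [t] from [w] and is stable under reduction of [w]. *)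
Inductive elnf : ctx -> sty -> htm sym -> htm sym -> Prop :=
| elnf_lam D a b t w : elnf (scons a D) b t w -> elnf D (arr a b) (HLam t) (HLam w)
| elnf_eta D a b t w :
    neutral w -> elnf (scons a D) b t (HApp (hren S w) (HVar 0)) -> elnf D (arr a b) (HLam t) w
| elnf_neu D t w : eneu D base t w -> elnf D base t w
with eneu : ctx -> sty -> htm sym -> htm sym -> Prop :=
| eneu_var D x : eneu D (D x) (HVar x) (HVar x)
| eneu_cst D c : eneu D (sym_ty c) (HCst c) (HCst c)
| eneu_app D a b t u f w :
    eneu D (arr a b) t f -> elnf D a u w -> eneu D b (HApp t u) (HApp f w).

Scheme elnf_mut_ind := Induction for elnf Sort Prop
with eneu_mut_ind := Induction for eneu Sort Prop.
Combined Scheme elnf_eneu_ind from elnf_mut_ind, eneu_mut_ind.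

Scheme lnf_mut_ind := Induction for lnf Sort Prop
with neu_mut_ind := Induction for neu Sort Prop.
Combined Scheme lnf_neu_ind from lnf_mut_ind, neu_mut_ind.

Hint Constructors elnf eneu lnf neu : core.

Lemma lnf_elnf :
  (forall D a t, lnf sym_ty D a t -> elnf D a t t) /\
  (forall D a t, neu sym_ty D a t -> eneu D a t t).
Proof.
apply (@lnf_neu_ind sym sym_ty (fun D a t _ => elnf D a t t) (fun D a t _ => eneu D a t t)); eauto.
Qed.

Lemma eneu_neutral D a t w : eneu D a t w -> neutral w.
Proof. induction 1; simpl; auto. Qed.

Lemma elnf_app_neutral D a t f u : elnf D a t (HApp f u) -> neutral f.
Proof. intros H; inversion H; subst; auto. apply eneu_neutral in H0; auto. Qed.

(** At an arrow type the shape of [w], abstraction or neutral, selects the only applicable rule. For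
    neutral terms the type is not given but forced by the head, which is why [eneu] also determines
    [a]. *)
Lemma elnf_functional :
  (forall D a t w, elnf D a t w -> forall t', elnf D a t' w -> t = t') /\
  (forall D a t w, eneu D a t w -> forall a' t', eneu D a' t' w -> a = a' /\ t = t').
Proof.
apply (@elnf_eneu_ind (fun D a t w _ => forall t', elnf D a t' w -> t = t')
  (fun D a t w _ => forall a' t', eneu D a' t' w -> a = a' /\ t = t')).
- intros D a b t w H IH t' H'; inversion H'; subst; simpl in *; [|tauto]. f_equal; auto.
- intros D a b t w N H IH t' H'; inversion H'; subst; simpl in *; [tauto|]. f_equal; auto.
- intros D t w H IH t' H'; inversion H'; subst. eapply IH; eauto.
- intros D x a' t' H'; inversion H'; auto.
- intros D c a' t' H'; inversion H'; auto.
- intros D a b t u f w Hf IHf Hw IHw a' t' H'; inversion H'; subst.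
  match goal with H : eneu _ _ _ f |- _ => destruct (IHf _ _ H) as [E ->] end.
  inversion E; subst; split; f_equal; auto.
Qed.

Lemma neutral_hren t xi : neutral (hren xi t) <-> neutral t.
Proof. revert xi; induction t; simpl; intros; auto; tauto. Qed.

Lemma par_neutral t t' : neutral t -> par t t' -> neutral t'.
Proof. intros N H; induction H; simpl in *; tauto. Qed.

(** A function part in [eneu] is neutral, so no beta-redex occurs and only eta steps remain.
    Contracting one turns a use of [elnf_lam] into a use of [elnf_eta]. *)
Lemma elnf_par :
  (forall D a t w, elnf D a t w -> forall w', par w w' -> elnf D a t w') /\
  (forall D a t w, eneu D a t w -> forall w', par w w' -> eneu D a t w').
Proof.
apply (@elnf_eneu_ind (fun D a t w _ => forall w', par w w' -> elnf D a t w')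
  (fun D a t w _ => forall w', par w w' -> eneu D a t w')).
- intros D a b t w H IH w' P; inversion P; subst; auto.
  (* The neutrality demanded by [elnf_eta] is read off this judgement, in which [hren S w'] stands
     in function position. *)
  assert (E : elnf (scons a D) b t (HApp (hren S w') (HVar 0))) by auto using par_hren.
  constructor; auto. now apply elnf_app_neutral, neutral_hren in E.
- intros D a b t w N H IH w' P. apply elnf_eta; eauto using par_neutral, par_hren.
- intros D t w H IH w' P; auto.
- intros D x w' P; inversion P; auto.
- intros D c w' P; inversion P; auto.
- intros D a b t u f w Hf IHf Hw IHw w' P; inversion P; subst; eauto.
  apply eneu_neutral in Hf; destruct Hf.
Qed.

Lemma elnf_pars D a t w w' : elnf D a t w -> pars w w' -> elnf D a t w'.
Proof. intros H P; induction P; auto. apply IHP; eapply elnf_par; eauto. Qed.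

Lemma lnf_unique D a t t' :
  lnf sym_ty D a t -> lnf sym_ty D a t' -> betaeta_eq t t' -> t = t'.
Proof.
intros H H' E; destruct (betaeta_eq_joinable E) as [w [P P']].
apply lnf_elnf in H, H'.
apply (proj1 elnf_functional D a t w); eauto using elnf_pars.
Qed.

(** * Typing and long normal forms under renaming and substitution *)

Lemma lnf_hren :
  (forall D a t, lnf sym_ty D a t ->
    forall E xi, (forall x, E (xi x) = D x) -> lnf sym_ty E a (hren xi t)) /\
  (forall D a t, neu sym_ty D a t ->
    forall E xi, (forall x, E (xi x) = D x) -> neu sym_ty E a (hren xi t)).
Proof.
apply (@lnf_neu_ind sym sym_ty
  (fun D a t _ => forall E xi, (forall x, E (xi x) = D x) -> lnf sym_ty E a (hren xi t))
  (fun D a t _ => forall E xi, (forall x, E (xi x) = D x) -> neu sym_ty E a (hren xi t)));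
  simpl; intros; eauto.
- constructor; apply H; intros [|x]; simpl; auto.
- rewrite <- H; auto.
Qed.

Lemma lnf_has_type :
  (forall D a t, lnf sym_ty D a t -> has_type sym_ty D a t) /\
  (forall D a t, neu sym_ty D a t -> has_type sym_ty D a t).
Proof.
apply (@lnf_neu_ind sym sym_ty
  (fun D a t _ => has_type sym_ty D a t) (fun D a t _ => has_type sym_ty D a t));
  intros; try constructor; auto. econstructor; eauto.
Qed.

Lemma has_type_hren D a t : has_type sym_ty D a t ->
  forall E xi, (forall x, E (xi x) = D x) -> has_type sym_ty E a (hren xi t).
Proof.
induction 1; simpl; intros E xi HE.
- rewrite <- HE; constructor.
- constructor.
- econstructor; eauto.
- constructor; apply IHhas_type; intros [|x]; simpl; auto.
Qed.

Lemma has_type_hsubst D a t : has_type sym_ty D a t ->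
  forall E s, (forall x, has_type sym_ty E (D x) (s x)) -> has_type sym_ty E a (hsubst s t).
Proof.
induction 1; simpl; intros E s HE; auto.
- constructor.
- econstructor; eauto.
- constructor; apply IHhas_type; intros [|x]; simpl.
  + apply (ht_var sym_ty (scons a E) 0).
  + eapply has_type_hren; eauto.
Qed.

Lemma betaeta_beta t u : betaeta_eq (HApp (HLam t) u) (hsubst (scons u HVar) t).
Proof. apply rst_step, hc_root; left; constructor. Qed.

Lemma betaeta_app t t' u u' :
  betaeta_eq t t' -> betaeta_eq u u' -> betaeta_eq (HApp t u) (HApp t' u').
Proof.
intros H H'; apply rst_trans with (HApp t' u).
- revert H; apply clos_rst_map with (f := fun t => HApp t u);
  intros; apply rst_step, hc_appl; auto.
- revert H'; apply clos_rst_map with (f := fun u => HApp t' u);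
  intros; apply rst_step, hc_appr; auto.
Qed.

Lemma betaeta_lam t t' : betaeta_eq t t' -> betaeta_eq (HLam t) (HLam t').
Proof.
apply clos_rst_map with (f := @HLam sym); intros; apply rst_step, hc_lam; auto.
Qed.

End Substitution.

(** * Properties of the encoding *)

Section Encoding.

Variables oc tc : Type.
Notation ob := (obj oc tc).
Notation tp := (ty oc tc).
Notation tm := (etm oc tc).
Notation sig := (@esym_ty oc tc).

Definition base_ctx (D : ctx) : Prop := forall x, D x = base.

Lemma base_ctx_scons D : base_ctx D -> base_ctx (scons base D).
Proof. intros H [|x]; simpl; auto. Qed.
Hint Resolve base_ctx_scons : core.

Lemma enc_ren :
  (forall (t : ob) xi, oenc (oren xi t) = hren xi (oenc t)) /\
  (forall (U : tp) xi, tenc (tren xi U) = hren xi (tenc U)).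
Proof.
apply (@obj_ty_ind oc tc (fun t => forall xi, oenc (oren xi t) = hren xi (oenc t))
  (fun U => forall xi, tenc (tren xi U) = hren xi (tenc U))); simpl; intros;
  unfold happ, hlam, hpi; congruence.
Qed.

Lemma enc_subst :
  (forall (t : ob) s r, (forall x, r x = oenc (s x)) -> oenc (osubst s t) = hsubst r (oenc t)) /\
  (forall (U : tp) s r, (forall x, r x = oenc (s x)) -> tenc (tsubst s U) = hsubst r (tenc U)).
Proof.
assert (up : forall (s : nat -> ob) r, (forall x, r x = oenc (s x)) ->
  forall x, hup r x = oenc (oup s x)).
{ intros s r E [|x]; simpl; auto. rewrite E; symmetry; apply enc_ren. }
apply (@obj_ty_ind oc tc
  (fun t => forall s r, (forall x, r x = oenc (s x)) -> oenc (osubst s t) = hsubst r (oenc t))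
  (fun U => forall s r, (forall x, r x = oenc (s x)) -> tenc (tsubst s U) = hsubst r (tenc U)));
  simpl; intros; unfold happ, hlam, hpi; auto; repeat f_equal; auto.
Qed.

Lemma oenc_beta (t v : ob) : hsubst (scons (oenc v) HVar) (oenc t) = oenc (osubst (scons v Var) t).
Proof. symmetry; apply enc_subst; intros [|x]; reflexivity. Qed.

Lemma tenc_beta (V : tp) v : hsubst (scons (oenc v) HVar) (tenc V) = tenc (tsubst (scons v Var) V).
Proof. symmetry; apply enc_subst; intros [|x]; reflexivity. Qed.

Lemma neu_bin D c a b T1 T2 :
  sig c = arr a (arr b base) -> lnf sig D a T1 -> lnf sig D b T2 ->
  neu sig D base (HApp (HApp (HCst c) T1) T2).
Proof.
intros E H1 H2. apply neu_app with b; auto. apply neu_app with a; auto.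
rewrite <- E; constructor.
Qed.

Lemma neu_happ D T1 T2 : neu sig D base T1 -> neu sig D base T2 -> neu sig D base (happ T1 T2).
Proof. intros; eapply neu_bin; try reflexivity; constructor; auto. Qed.

Lemma neu_hlam D T1 T2 :
  neu sig D base T1 -> neu sig (scons base D) base T2 -> neu sig D base (hlam T1 T2).
Proof. intros; eapply neu_bin; try reflexivity; repeat constructor; auto. Qed.

Lemma neu_hpi D T1 T2 :
  neu sig D base T1 -> neu sig (scons base D) base T2 -> neu sig D base (hpi T1 T2).
Proof. intros; eapply neu_bin; try reflexivity; repeat constructor; auto. Qed.

Lemma enc_neu :
  (forall (t : ob) D, base_ctx D -> neu sig D base (oenc t)) /\
  (forall (U : tp) D, base_ctx D -> neu sig D base (tenc U)).
Proof.
apply (@obj_ty_ind oc tc (fun t => forall D, base_ctx D -> neu sig D base (oenc t))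
  (fun U => forall D, base_ctx D -> neu sig D base (tenc U))); simpl; intros;
  auto using neu_happ, neu_hlam, neu_hpi.
- rewrite <- (H x); constructor.
- apply (neu_cst sig D (SObj tc c)).
- apply (neu_cst sig D (STy oc C)).
Qed.

Definition oenc_neu := proj1 enc_neu.
Definition tenc_neu := proj2 enc_neu.

Lemma kenc_neu (K : kind oc tc) D : base_ctx D -> neu sig D base (kenc K).
Proof.
revert D; induction K; simpl; intros.
- apply (neu_cst sig D (SType oc tc)).
- auto using neu_hpi, tenc_neu.
Qed.

(** A left inverse of [enc], from which injectivity follows. Since [app] and [lam] serve objects and
    types, and [pi] serves types and kinds, the syntactic class has to be recovered from the
    subterms. *)
Fixpoint decode (t : tm) : option (term oc tc) :=
  match t with
  | HVar x => Some (TmObj (Var x))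
  | HCst (SType _ _) => Some (TmKind KType)
  | HCst (SKind _ _) => Some TmKIND
  | HCst (SObj _ c) => Some (TmObj (Cst c))
  | HCst (STy _ C) => Some (TmTy (TCst C))
  | HApp (HApp (HCst (SApp _ _)) a) b =>
      match decode a, decode b with
      | Some (TmObj t), Some (TmObj u) => Some (TmObj (App t u))
      | Some (TmTy U), Some (TmObj u) => Some (TmTy (TApp U u))
      | _, _ => None
      end
  | HApp (HApp (HCst (SLam _ _)) a) (HLam b) =>
      match decode a, decode b with
      | Some (TmTy U), Some (TmObj t) => Some (TmObj (Lam U t))
      | Some (TmTy U), Some (TmTy V) => Some (TmTy (TLam U V))
      | _, _ => None
      end
  | HApp (HApp (HCst (SPi _ _)) a) (HLam b) =>
      match decode a, decode b with
      | Some (TmTy U), Some (TmTy V) => Some (TmTy (TPi U V))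
      | Some (TmTy U), Some (TmKind K) => Some (TmKind (KPi U K))
      | _, _ => None
      end
  | _ => None
  end.

Lemma decode_enc t : decode (enc t) = Some t.
Proof.
assert (E : (forall t : ob, decode (oenc t) = Some (TmObj t)) /\
            (forall U : tp, decode (tenc U) = Some (TmTy U))).
{ apply (@obj_ty_ind oc tc (fun t => decode (oenc t) = Some (TmObj t))
    (fun U => decode (tenc U) = Some (TmTy U))); simpl; intros; auto;
    rewrite H, H0; reflexivity. }
destruct E as [Eo Et], t as [t|U|K|]; simpl; auto.
induction K; simpl; auto. rewrite Et, IHK; reflexivity.
Qed.

Lemma enc_inj (t u : term oc tc) : enc t = enc u -> t = u.
Proof. intros E; apply (f_equal decode) in E; rewrite !decode_enc in E; congruence. Qed.

Lemma oenc_inj (t u : ob) : oenc t = oenc u -> t = u.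
Proof. intros E; assert (H : TmObj t = TmObj u) by now apply enc_inj. congruence. Qed.

Lemma tenc_inj (U V : tp) : tenc U = tenc V -> U = V.
Proof. intros E; assert (H : TmTy U = TmTy V) by now apply enc_inj. congruence. Qed.

(** A renaming changes variables only, so the shape of an encoding was there before it. This carries
    encodings found in a redex, where the bodies of the substituted abstractions appear renamed,
    back to the substitution. *)
Lemma enc_ren_reflect :
  (forall (t : ob) xi T, hren xi T = oenc t -> exists t', T = oenc t') /\
  (forall (U : tp) xi T, hren xi T = tenc U -> exists U', T = tenc U').
Proof.
assert (bin : forall xi (T : tm) c T1 T2, hren xi T = HApp (HApp (HCst c) T1) T2 ->
  exists T1' T2', T = HApp (HApp (HCst c) T1') T2' /\ hren xi T1' = T1 /\ hren xi T2' = T2).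
{ intros xi T c T1 T2 E; destruct T as [| |[| |[| | |]|]|]; inversion E; eauto. }
assert (bil : forall xi (T : tm) c T1 T2, hren xi T = HApp (HApp (HCst c) T1) (HLam T2) ->
  exists T1' T2', T = HApp (HApp (HCst c) T1') (HLam T2') /\ hren xi T1' = T1 /\
    hren (upren xi) T2' = T2).
{ intros xi T c T1 T2 E; apply bin in E as [T1' [T2' [-> [E1 E2]]]].
  apply hren_eq_lam in E2 as [T3 [-> ->]]; eauto. }
apply (@obj_ty_ind oc tc (fun t => forall xi T, hren xi T = oenc t -> exists t', T = oenc t')
  (fun U => forall xi T, hren xi T = tenc U -> exists U', T = tenc U'));
  simpl; unfold happ, hlam, hpi.
- intros x xi [] E; inversion E; eexists (Var _); reflexivity.
- intros c xi [] E; inversion E; exists (Cst c); reflexivity.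
- intros t IHt u IHu xi T E; apply bin in E as [T1 [T2 [-> [E1 E2]]]].
  destruct (IHt _ _ E1) as [t' ->], (IHu _ _ E2) as [u' ->]; exists (App t' u'); reflexivity.
- intros U IHU t IHt xi T E; apply bil in E as [T1 [T2 [-> [E1 E2]]]].
  destruct (IHU _ _ E1) as [U' ->], (IHt _ _ E2) as [t' ->]; exists (Lam U' t'); reflexivity.
- intros C xi [] E; inversion E; exists (TCst C); reflexivity.
- intros U IHU t IHt xi T E; apply bin in E as [T1 [T2 [-> [E1 E2]]]].
  destruct (IHU _ _ E1) as [U' ->], (IHt _ _ E2) as [t' ->]; exists (TApp U' t'); reflexivity.
- intros U IHU V IHV xi T E; apply bil in E as [T1 [T2 [-> [E1 E2]]]].
  destruct (IHU _ _ E1) as [U' ->], (IHV _ _ E2) as [V' ->]; exists (TLam U' V'); reflexivity.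
- intros U IHU V IHV xi T E; apply bil in E as [T1 [T2 [-> [E1 E2]]]].
  destruct (IHU _ _ E1) as [U' ->], (IHV _ _ E2) as [V' ->]; exists (TPi U' V'); reflexivity.
Qed.

(** * Instances of encoded rules *)

Definition obeta_eq : relation ob := clos_refl_sym_trans ob (ostep (@obeta oc tc) (@tbeta oc tc)).
Definition tbeta_eq : relation tp := clos_refl_sym_trans tp (tstep (@obeta oc tc) (@tbeta oc tc)).

Lemma obeta_eq_app t t' u u' :
  obeta_eq t t' -> obeta_eq u u' -> obeta_eq (App t u) (App t' u').
Proof.
intros H H'; apply rst_trans with (App t' u).
- revert H; apply clos_rst_map with (f := fun t => App t u);
  intros; apply rst_step, ostep_appl; auto.
- revert H'; apply clos_rst_map with (f := fun u => App t' u);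
  intros; apply rst_step, ostep_appr; auto.
Qed.

Lemma obeta_eq_lam U U' t t' :
  tbeta_eq U U' -> obeta_eq t t' -> obeta_eq (Lam U t) (Lam U' t').
Proof.
intros H H'; apply rst_trans with (Lam U' t).
- revert H; apply clos_rst_map with (f := fun U => Lam U t);
  intros; apply rst_step, ostep_laml; auto.
- revert H'; apply clos_rst_map with (f := fun t => Lam U' t);
  intros; apply rst_step, ostep_lamr; auto.
Qed.

Lemma tbeta_eq_app U U' t t' :
  tbeta_eq U U' -> obeta_eq t t' -> tbeta_eq (TApp U t) (TApp U' t').
Proof.
intros H H'; apply rst_trans with (TApp U' t).
- revert H; apply clos_rst_map with (f := fun U => TApp U t);
  intros; apply rst_step, tstep_appl; auto.
- revert H'; apply clos_rst_map with (f := fun t => TApp U' t);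
  intros; apply rst_step, tstep_appr; auto.
Qed.

Lemma tbeta_eq_lam U U' V V' :
  tbeta_eq U U' -> tbeta_eq V V' -> tbeta_eq (TLam U V) (TLam U' V').
Proof.
intros H H'; apply rst_trans with (TLam U' V).
- revert H; apply clos_rst_map with (f := fun U => TLam U V);
  intros; apply rst_step, tstep_laml; auto.
- revert H'; apply clos_rst_map with (f := fun V => TLam U' V);
  intros; apply rst_step, tstep_lamr; auto.
Qed.

Lemma tbeta_eq_pi U U' V V' :
  tbeta_eq U U' -> tbeta_eq V V' -> tbeta_eq (TPi U V) (TPi U' V').
Proof.
intros H H'; apply rst_trans with (TPi U' V).
- revert H; apply clos_rst_map with (f := fun U => TPi U V);
  intros; apply rst_step, tstep_pil; auto.
- revert H'; apply clos_rst_map with (f := fun V => TPi U' V);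
  intros; apply rst_step, tstep_pir; auto.
Qed.

Lemma betaeta_bin (c : esym oc tc) T1 T1' T2 T2' :
  betaeta_eq T1 T1' -> betaeta_eq T2 T2' ->
  betaeta_eq (HApp (HApp (HCst c) T1) T2) (HApp (HApp (HCst c) T1') T2').
Proof. intros; repeat apply betaeta_app; auto; apply rst_refl. Qed.

(** * Instantiating a term and its encoding in parallel *)

Section Simulation.

(* [Rep n o T]: the HRS term [T] of type [term^(n+1)] stands for the object
   [o] that is going to be applied to [n] arguments. *)
Variable Rep : nat -> ob -> tm -> Prop.
Hypothesis Rep_0 : forall o T, Rep 0 o T -> T = oenc o.
Hypothesis Rep_shift : forall n o T, Rep n o T -> Rep n (oren S o) (hren S T).
Hypothesis Rep_app : forall n o T r, Rep (S n) o T ->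
  exists o' T', obeta_eq (App o r) o' /\ betaeta_eq (HApp T (oenc r)) T' /\ Rep n o' T'.

(** Both sides are beta-converted to a common result, the source by [sg] and the HRS term by [s].
    Under a variable outside [V] the count [m] of pending arguments is tracked, and [Rep_app]
    consumes them one by one; everywhere else the result is an encoding. Leaving [Rep] abstract lets
    both directions of the theorem share the argument. *)
Lemma encV_simulation :
  (forall (t : ob) V sg s m,
    (forall x, V x = true -> s x = oenc (sg x)) ->
    (forall x n, In (x, n) (oocc 0 m t) -> V x = false -> Rep n (sg x) (s x)) ->
    exists o T, obeta_eq (osubst sg t) o /\ betaeta_eq (hsubst s (oencV V t)) T /\
      if flex V t then Rep m o T else T = oenc o) /\
  (forall (U : tp) V sg s,
    (forall x, V x = true -> s x = oenc (sg x)) ->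
    (forall x n, In (x, n) (tocc 0 U) -> V x = false -> Rep n (sg x) (s x)) ->
    exists W, tbeta_eq (tsubst sg U) W /\ betaeta_eq (hsubst s (tencV V U)) (tenc W)).
Proof.
assert (up : forall (V : nat -> bool) sg (s : nat -> tm),
  (forall x, V x = true -> s x = oenc (sg x)) ->
  forall x, scons true V x = true -> hup s x = oenc (oup sg x)).
{ intros V sg s E [|x]; simpl; auto. intros Vx; rewrite E by auto; symmetry; apply enc_ren. }
(* With no argument pending, the flexible and the rigid outcome both say that [T] is an encoding. *)
assert (flat : forall (b : bool) o T, (if b then Rep 0 o T else T = oenc o) -> T = oenc o)
  by (intros []; auto).
apply (@obj_ty_ind oc tc (fun t => forall V sg s m,
    (forall x, V x = true -> s x = oenc (sg x)) ->
    (forall x n, In (x, n) (oocc 0 m t) -> V x = false -> Rep n (sg x) (s x)) ->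
    exists o T, obeta_eq (osubst sg t) o /\ betaeta_eq (hsubst s (oencV V t)) T /\
      if flex V t then Rep m o T else T = oenc o)
  (fun U => forall V sg s,
    (forall x, V x = true -> s x = oenc (sg x)) ->
    (forall x n, In (x, n) (tocc 0 U) -> V x = false -> Rep n (sg x) (s x)) ->
    exists W, tbeta_eq (tsubst sg U) W /\ betaeta_eq (hsubst s (tencV V U)) (tenc W))); simpl.
- intros x V sg s m HV HR; exists (sg x), (s x); split; [apply rst_refl|split; [apply rst_refl|]].
  destruct (V x) eqn:Vx; simpl; auto. apply HR; auto. rewrite Nat.sub_0_r; auto.
- intros c V sg s m HV HR; exists (Cst c), (oenc (Cst c)); repeat split; apply rst_refl.
- intros t IHt u IHu V sg s m HV HR.
  destruct (IHt V sg s (S m)) as [o1 [T1 [A1 [B1 C1]]]]; auto.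
  { intros; apply HR; auto; apply in_app_iff; auto. }
  destruct (IHu V sg s 0) as [o2 [T2 [A2 [B2 C2]]]]; auto.
  { intros; apply HR; auto; apply in_app_iff; auto. }
  apply flat in C2; subst T2. destruct (flex V t); simpl.
  + destruct (Rep_app o2 C1) as [o' [T' [A [B C]]]]; exists o', T'; repeat split; auto.
    * eapply rst_trans; [apply obeta_eq_app|]; eauto.
    * eapply rst_trans; [apply betaeta_app|]; eauto.
  + subst T1; exists (App o1 o2), (oenc (App o1 o2)); split; [|split]; auto.
    * now apply obeta_eq_app.
    * now apply betaeta_bin.
- intros U IHU t IHt V sg s m HV HR.
  destruct (IHU V sg s) as [W [A1 B1]]; auto.
  { intros; apply HR; auto; apply in_app_iff; auto. }
  destruct (IHt (scons true V) (oup sg) (hup s) 0) as [o [T [A2 [B2 C2]]]]; eauto.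
  { intros [|x] n Hx Vx; simpl in *; [discriminate|]. apply Rep_shift, HR; auto.
    apply in_app_iff; right; now apply occ_under. }
  apply flat in C2; subst T. exists (Lam W o), (oenc (Lam W o)); split; [|split]; auto.
  + now apply obeta_eq_lam.
  + apply betaeta_bin; auto; now apply betaeta_lam.
- intros C V sg s HV HR; exists (TCst C); split; apply rst_refl.
- intros U IHU t IHt V sg s HV HR.
  destruct (IHU V sg s) as [W [A1 B1]]; auto.
  { intros; apply HR; auto; apply in_app_iff; auto. }
  destruct (IHt V sg s 0) as [o2 [T2 [A2 [B2 C2]]]]; auto.
  { intros; apply HR; auto; apply in_app_iff; auto. }
  apply flat in C2; subst T2. exists (TApp W o2); split.
  + now apply tbeta_eq_app.
  + now apply betaeta_bin.
- intros U IHU U2 IHU2 V sg s HV HR.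
  destruct (IHU V sg s) as [W [A1 B1]]; auto.
  { intros; apply HR; auto; apply in_app_iff; auto. }
  destruct (IHU2 (scons true V) (oup sg) (hup s)) as [W2 [A2 B2]]; eauto.
  { intros [|x] n Hx Vx; simpl in *; [discriminate|]. apply Rep_shift, HR; auto.
    apply in_app_iff; right; now apply occ_under. }
  exists (TLam W W2); split.
  + now apply tbeta_eq_lam.
  + apply betaeta_bin; auto; now apply betaeta_lam.
- intros U IHU U2 IHU2 V sg s HV HR.
  destruct (IHU V sg s) as [W [A1 B1]]; auto.
  { intros; apply HR; auto; apply in_app_iff; auto. }
  destruct (IHU2 (scons true V) (oup sg) (hup s)) as [W2 [A2 B2]]; eauto.
  { intros [|x] n Hx Vx; simpl in *; [discriminate|]. apply Rep_shift, HR; auto.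
    apply in_app_iff; right; now apply occ_under. }
  exists (TPi W W2); split.
  + now apply tbeta_eq_pi.
  + apply betaeta_bin; auto; now apply betaeta_lam.
Qed.

Lemma oencV_simulation (t : ob) sg s :
  (forall x n, In (x, n) (oocc 0 0 t) -> Rep n (sg x) (s x)) ->
  exists o, obeta_eq (osubst sg t) o /\ betaeta_eq (hsubst s (oencV vempty t)) (oenc o).
Proof.
intros H; destruct (proj1 encV_simulation t vempty sg s 0) as [o [T [A [B C]]]]; auto.
{ intros x E; discriminate E. }
exists o; split; auto. destruct (flex vempty t); [rewrite <- (Rep_0 C)|rewrite <- C]; auto.
Qed.

Lemma tencV_simulation (U : tp) sg s :
  (forall x n, In (x, n) (tocc 0 U) -> Rep n (sg x) (s x)) ->
  exists W, tbeta_eq (tsubst sg U) W /\ betaeta_eq (hsubst s (tencV vempty U)) (tenc W).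
Proof.
intros H; apply (proj2 encV_simulation); auto. intros x E; discriminate E.
Qed.

End Simulation.

(** * Two representations of objects as values of an HRS substitution *)

Fixpoint eta_expand (n : nat) (T : tm) : tm :=
  match n with
  | 0 => T
  | S n => HLam (eta_expand n (happ (hren S T) (HVar 0)))
  end.

Lemma eta_expand_hsubst n T s : hsubst s (eta_expand n T) = eta_expand n (hsubst s T).
Proof.
revert T s; induction n; simpl; intros T s; auto.
rewrite IHn; simpl; unfold happ; now rewrite hsubst_hup_S.
Qed.

Lemma eta_expand_lnf n T D : base_ctx D -> neu sig D base T -> lnf sig D (tpow n) (eta_expand n T).
Proof.
revert T D; induction n; simpl; intros T D HD HT; constructor; auto.
apply IHn; auto. apply neu_happ.
- eapply lnf_hren; eauto.
- apply (neu_var sig (scons base D) 0).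
Qed.

(** The representation for a given source substitution. It exists for every object, abstraction or
    not: applying it to an encoded argument beta-reduces to [app], so the source side takes no
    step. *)
Definition eta_rep (n : nat) (o : ob) (T : tm) : Prop := T = eta_expand n (oenc o).

Lemma eta_rep_0 o T : eta_rep 0 o T -> T = oenc o.
Proof. auto. Qed.

Lemma eta_rep_shift n o T : eta_rep n o T -> eta_rep n (oren S o) (hren S T).
Proof.
intros ->; unfold eta_rep. rewrite (proj1 enc_ren), !hren_hsubst; apply eta_expand_hsubst.
Qed.

Lemma eta_rep_app n o T r : eta_rep (S n) o T ->
  exists o' T', obeta_eq (App o r) o' /\ betaeta_eq (HApp T (oenc r)) T' /\ eta_rep n o' T'.
Proof.
intros ->; exists (App o r); eexists; split; [apply rst_refl|split; [apply betaeta_beta|]].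
unfold eta_rep; rewrite eta_expand_hsubst; unfold happ; simpl. now rewrite hsubst_scons_S.
Qed.

(** The representation for a given HRS substitution: its abstractions become source abstractions,
    and both sides consume an argument by a beta step. HRS abstractions carry no annotation, so [U]
    is free. *)
Inductive lam_rep : nat -> ob -> tm -> Prop :=
| lam_rep_0 o : lam_rep 0 o (oenc o)
| lam_rep_S n U o T : lam_rep n o T -> lam_rep (S n) (Lam U o) (HLam T).

Lemma lam_rep_oenc o T : lam_rep 0 o T -> T = oenc o.
Proof. inversion 1; auto. Qed.

Lemma lam_rep_ren n o T : lam_rep n o T -> forall xi, lam_rep n (oren xi o) (hren xi T).
Proof.
induction 1; simpl; intros xi.
- rewrite <- (proj1 enc_ren); constructor.
- constructor; auto.
Qed.

Lemma lam_rep_subst n o T : lam_rep n o T ->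
  forall s r, (forall x, r x = oenc (s x)) -> lam_rep n (osubst s o) (hsubst r T).
Proof.
induction 1; simpl; intros s r E.
- rewrite <- (proj1 enc_subst _ s r E); constructor.
- constructor; apply IHlam_rep. intros [|x]; simpl; auto. rewrite E; symmetry; apply enc_ren.
Qed.

Lemma lam_rep_shift n o T : lam_rep n o T -> lam_rep n (oren S o) (hren S T).
Proof. intros H; now apply lam_rep_ren. Qed.

Lemma lam_rep_app n o T r : lam_rep (S n) o T ->
  exists o' T', obeta_eq (App o r) o' /\ betaeta_eq (HApp T (oenc r)) T' /\ lam_rep n o' T'.
Proof.
inversion 1; subst. exists (osubst (scons r Var) o0); eexists.
split; [apply rst_step, ostep_root; constructor|split; [apply betaeta_beta|]].
apply lam_rep_subst; auto. intros [|x]; reflexivity.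
Qed.

Lemma lam_rep_ren_reflect n T xi o : lam_rep n o (hren xi T) -> exists o', lam_rep n o' T.
Proof.
revert T xi o; induction n; intros T xi o H; inversion H; subst.
- destruct (proj1 enc_ren_reflect o xi T) as [o' ->]; auto. exists o'; constructor.
- match goal with E : HLam _ = hren _ _ |- _ =>
    symmetry in E; apply hren_eq_lam in E as [T1 [-> ->]] end.
  match goal with L : lam_rep n _ _ |- _ => destruct (IHn _ _ _ L) as [o' Ho] end.
  exists (Lam U o'); constructor; auto.
Qed.

(** * Matching against the encoding of a pattern *)

Lemma betaeta_happs (us : list tm) T T' : betaeta_eq T T' -> betaeta_eq (happs T us) (happs T' us).
Proof.
revert T T'; induction us; simpl; intros T T' H; auto.
apply IHus, betaeta_app; auto; apply rst_refl.
Qed.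

(* The type annotation of the abstractions in [o] is arbitrary, but a type
   has to exist. *)
Lemma lam_rep_of_vars (ys : list nat) D T :
  base_ctx D -> (ys <> [] -> inhabited tp) -> lnf sig D (tpow (length ys)) T ->
  exists w, betaeta_eq (happs T (map HVar ys)) w /\ neu sig D base w /\
    forall t, w = oenc t -> exists o, lam_rep (length ys) o T.
Proof.
revert T; induction ys as [|y ys IH]; simpl; intros T HD I H.
- exists T; split; [apply rst_refl|split].
  + inversion H; auto.
  + intros t ->; exists t; constructor.
- inversion H; subst.
  (* Applying an abstraction to a variable merely renames its body, so the contractum is still in
     long normal form and no further redex has to be controlled. *)
  destruct (IH (hren (scons y (fun x => x)) t)) as [w [A [B C]]]; auto.
  { intros _; apply I; discriminate. }
  { eapply lnf_hren; eauto. intros [|x]; simpl; auto. }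
  exists w; split; [|split]; auto.
  + eapply rst_trans; [|exact A]. apply betaeta_happs.
    rewrite <- hsubst_scons_var; apply betaeta_beta.
  + intros t' E; destruct (C _ E) as [o Ho]. apply lam_rep_ren_reflect in Ho as [o' Ho].
    destruct I as [U]; [discriminate|]. exists (Lam U o'); constructor; auto.
Qed.

Lemma oocc_apps (us : list ob) t k m p :
  In p (oocc k m (apps t us)) <->
  In p (oocc k (m + length us) t) \/ exists u, In u us /\ In p (oocc k 0 u).
Proof.
revert t m; induction us as [|u us IH]; simpl; intros t m.
- rewrite Nat.add_0_r; firstorder.
- rewrite IH; simpl. rewrite in_app_iff, <- plus_n_Sm. firstorder; subst; auto.
Qed.

Lemma hsubst_happs (us : list tm) t s :
  hsubst s (happs t us) = happs (hsubst s t) (map (hsubst s) us).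
Proof. revert t; induction us; simpl; auto. Qed.

Definition instance_ok (V : nat -> bool) (D : ctx) (l : list (nat * nat)) (s : nat -> tm) : Prop :=
  base_ctx D /\
  (forall x, V x = true -> inhabited tp) /\
  (forall x, V x = true -> exists y, s x = HVar y) /\
  (forall x n, In (x, n) l -> V x = false -> lnf sig D (tpow n) (s x)).

Definition all_lam_rep (V : nat -> bool) (l : list (nat * nat)) (s : nat -> tm) : Prop :=
  forall x n, In (x, n) l -> V x = false -> exists o, lam_rep n o (s x).

Lemma instance_ok_incl V D l l' s : incl l' l -> instance_ok V D l s -> instance_ok V D l' s.
Proof. intros I [H1 [H2 [H3 H4]]]; split; [|split; [|split]]; auto. Qed.

(** Instantiating a pattern creates beta-redexes only where a free variable meets bound variables,
    and these contract to renamings. So [w] is built along the pattern, and if it is an encoding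
    then so is every substituted body in it. As [app] is shared, [q] could a priori be a type; the
    head of an object pattern, a constant or a bound variable, excludes this. *)
Lemma pattern_match :
  (forall V A (p : ob), opat V A p -> forall D s m, instance_ok V D (oocc 0 m p) s ->
    exists w, betaeta_eq (hsubst s (oencV V p)) w /\ neu sig D base w /\
      forall q, w = enc q -> (exists t, q = TmObj t) /\ all_lam_rep V (oocc 0 m p) s) /\
  (forall V A (p : ob), parg V A p -> forall D s, instance_ok V D (oocc 0 0 p) s ->
    exists w, betaeta_eq (hsubst s (oencV V p)) w /\ neu sig D base w /\
      forall t, w = oenc t -> all_lam_rep V (oocc 0 0 p) s).
Proof.
apply (@opat_parg_ind oc tc
 (fun V A (p : ob) _ => forall D s m, instance_ok V D (oocc 0 m p) s ->
    exists w, betaeta_eq (hsubst s (oencV V p)) w /\ neu sig D base w /\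
      forall q, w = enc q -> (exists t, q = TmObj t) /\ all_lam_rep V (oocc 0 m p) s)
 (fun V A (p : ob) _ => forall D s, instance_ok V D (oocc 0 0 p) s ->
    exists w, betaeta_eq (hsubst s (oencV V p)) w /\ neu sig D base w /\
      forall t, w = oenc t -> all_lam_rep V (oocc 0 0 p) s)); simpl.
- intros V A c D s m _; exists (HCst (SObj tc c)); split; [apply rst_refl|split].
  + apply (neu_cst sig D (SObj tc c)).
  + intros q E; split; [|intros x n []]. exists (Cst c); now apply enc_inj.
- intros V A x Vx D s m [HD [_ [HV _]]]; destruct (HV x Vx) as [y Hy]; exists (HVar y).
  rewrite Hy; split; [apply rst_refl|split].
  + apply (oenc_neu (Var y) HD).
  + intros q E; split.
    * exists (Var y); now apply enc_inj.
    * intros z n [Hz|[]] Vz; inversion Hz; subst. rewrite Nat.sub_0_r in Vz; congruence.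
- intros V A p a Hp IHp Ha IHa D s m OK.
  destruct (IHp D s (S m)) as [w1 [A1 [B1 C1]]].
  { eapply instance_ok_incl; eauto. apply incl_appl, incl_refl. }
  destruct (IHa D s) as [w2 [A2 [B2 C2]]].
  { eapply instance_ok_incl; eauto. apply incl_appr, incl_refl. }
  rewrite (opat_flex Hp). exists (happ w1 w2); split; [|split].
  + now apply betaeta_bin.
  + now apply neu_happ.
  + intros [t|U|K|] E; try discriminate.
    * destruct t; try discriminate. inversion E; subst.
      destruct (C1 (TmObj t1) eq_refl) as [_ C]. split; eauto.
      intros x n Hx Vx; apply in_app_iff in Hx as [Hx|Hx]; eauto. eapply C2; eauto.
    * destruct U; try discriminate. inversion E; subst.
      destruct (C1 (TmTy U) eq_refl) as [[t' Ht'] _]; discriminate.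
    * destruct K; discriminate.
- intros V A q Hq IHq D s OK; destruct (IHq D s 0 OK) as [w [A1 [B1 C1]]].
  exists w; split; [|split]; auto. intros t ->. now apply (C1 (TmObj t)).
- intros V A x ys Vx _ HV _ D s [HD [HI [Hs HL]]].
  assert (occ : In (x, length ys) (oocc 0 0 (apps (Var x) (map Var ys) : ob))).
  { apply oocc_apps; left; simpl. rewrite length_map, Nat.sub_0_r; auto. }
  assert (Es : exists zs, length zs = length ys /\
    map (hsubst s) (map (oencV V) (map Var ys)) = map HVar zs).
  { clear - HV Hs; induction HV as [|y ys Vy _ [zs [E1 E2]]]; simpl.
    - exists []; auto.
    - destruct (Hs y Vy) as [z Hz]; exists (z :: zs); simpl; rewrite E1, E2, Hz; auto. }
  destruct Es as [zs [El Ez]].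
  destruct (@lam_rep_of_vars zs D (s x)) as [w [A1 [B1 C1]]]; auto.
  { intros N; destruct HV as [|y ys Vy _]; eauto. destruct zs; simpl in *; congruence. }
  { rewrite El; auto. }
  exists w; split; [|split]; auto.
  + rewrite encV_apps by (simpl; now rewrite Vx). rewrite hsubst_happs, Ez; auto.
  + intros t E z n Hz Vz. rewrite <- El in *.
    apply oocc_apps in Hz as [Hz|[u [Hu Hz]]]; simpl in Hz.
    * destruct Hz as [Hz|[]]; inversion Hz; subst. rewrite length_map, Nat.sub_0_r, <- El; eauto.
    * apply in_map_iff in Hu as [y [<- Hy]]; simpl in Hz.
      destruct Hz as [Hz|[]]; inversion Hz; subst; rewrite Nat.sub_0_r in *.
      rewrite Forall_forall in HV; rewrite HV in Vz; auto; discriminate.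
- intros V A U q HU Hq IHq D s [HD [HI [Hs HL]]].
  (* The annotation mentions only variables of [V], whose values are variables, so its instance is
     convertible to the encoding of a type. The default [Var 0] stands at values that [U] never
     meets. *)
  destruct (proj2 (@encV_simulation lam_rep lam_rep_oenc lam_rep_shift lam_rep_app) U V
    (fun x => match s x with HVar y => Var y | _ => Var 0 end) s) as [W [_ B]].
  { intros x Vx; destruct (Hs x Vx) as [y ->]; reflexivity. }
  { intros x n Hx Vx; rewrite HU in Vx; [discriminate|]. apply in_map_iff; exists (x, n); auto. }
  destruct (IHq (scons base D) (hup s) 0) as [w [A1 [B1 C1]]].
  { split; [|split; [|split]]; auto.
    - intros [|x]; simpl; auto. exists 0; auto. intros Vx; destruct (Hs x Vx) as [y ->].
      exists (S y); reflexivity.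
    - intros [|x] n Hx Vx; simpl in *; [discriminate|].
      eapply lnf_hren; [apply HL; auto; apply in_app_iff; right; apply occ_under; eauto|auto]. }
  exists (hlam (tenc W) w); split; [|split].
  + apply betaeta_bin; auto; now apply betaeta_lam.
  + apply neu_hlam; auto using tenc_neu.
  + intros t E; destruct t; try discriminate. inversion E; subst.
    destruct (C1 (TmObj t) eq_refl) as [_ C].
    intros x n Hx Vx; apply in_app_iff in Hx as [Hx|Hx].
    * rewrite HU in Vx; [discriminate|]. apply in_map_iff; exists (x, n); auto.
    (* Below the binder the value of [S x] is the shift of [s x]; reflecting the renaming returns to
       [s x] itself. *)
    * destruct (C (S x) n) as [o Ho]; auto; [now apply occ_under|].
      simpl in Ho; now apply lam_rep_ren_reflect in Ho.
Qed.

Lemma type_pattern_match V A (p : tp) : tpat V A p -> forall D s, instance_ok V D (tocc 0 p) s ->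
  exists w, betaeta_eq (hsubst s (tencV V p)) w /\ neu sig D base w /\
    forall q, w = enc q -> (exists U, q = TmTy U) /\ all_lam_rep V (tocc 0 p) s.
Proof.
induction 1 as [V A C|V A p a Hp IHp Ha]; simpl; intros D s OK.
- exists (HCst (STy oc C)); split; [apply rst_refl|split].
  + apply (neu_cst sig D (STy oc C)).
  + intros q E; split; [|intros x n []]. exists (TCst C); now apply enc_inj.
- destruct (IHp D s) as [w1 [A1 [B1 C1]]].
  { eapply instance_ok_incl; eauto. apply incl_appl, incl_refl. }
  destruct (proj2 pattern_match _ _ _ Ha D s) as [w2 [A2 [B2 C2]]].
  { eapply instance_ok_incl; eauto. apply incl_appr, incl_refl. }
  exists (happ w1 w2); split; [|split].
  + now apply betaeta_bin.
  + now apply neu_happ.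
  + intros [t|U|K|] E; try discriminate.
    * destruct t; try discriminate. inversion E; subst.
      destruct (C1 (TmObj t1) eq_refl) as [[t' Ht'] _]; discriminate.
    * destruct U; try discriminate. inversion E; subst.
      destruct (C1 (TmTy U) eq_refl) as [_ C]. split; eauto.
      intros x n Hx Vx; apply in_app_iff in Hx as [Hx|Hx]; eauto. eapply C2; eauto.
    * destruct K; discriminate.
Qed.

(** Matching yields a witness for each free variable separately. As there are finitely many, they
    form one substitution without an axiom of choice, with [a] filling the other positions. *)
Lemma finite_choice (X : Type) (P : nat -> X -> Prop) (a : X) (l : list nat) :
  (forall x, In x l -> exists b, P x b) -> exists f, forall x, In x l -> P x (f x).
Proof.
induction l as [|y l IH]; simpl; intros H.
- exists (fun _ => a); tauto.
- destruct IH as [f Hf]; auto. destruct (H y) as [b Hb]; auto.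
  exists (fun x => if Nat.eq_dec x y then b else f x).
  intros x Hx; destruct (Nat.eq_dec x y); subst; auto. apply Hf; intuition congruence.
Qed.

Lemma uniform_arity (l l' : list (nat * nat)) :
  incl (map fst l') (map fst l) -> uniform (l ++ l') ->
  forall x n, In (x, n) (l ++ l') -> n = arity l x.
Proof.
intros I U x n H; apply (U x); auto. apply in_app_iff; left; apply arity_In.
apply in_app_iff in H as [H|H]; [|apply I]; apply in_map_iff; exists (x, n); auto.
Qed.

Variable G : gctx oc tc.
Hypothesis HG : forall e, In e G -> encodable e.

Notation step_in D := (hstep sig (HRS_beta_gamma G) D).

(** * From the HRS to beta and the rules *)

Definition oeq : relation ob := clos_refl_sym_trans ob
  (fun t u => ostep (@obeta oc tc) (@tbeta oc tc) t u \/ ostep (orule G) (trule G) t u).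
Definition teq : relation tp := clos_refl_sym_trans tp
  (fun t u => tstep (@obeta oc tc) (@tbeta oc tc) t u \/ tstep (orule G) (trule G) t u).
Definition keq : relation (kind oc tc) := clos_refl_sym_trans (kind oc tc)
  (fun t u => kstep (@obeta oc tc) (@tbeta oc tc) t u \/ kstep (orule G) (trule G) t u).

(** There is no clause for kinds or [Kind]: a root redex among encodings always encodes an object or
    a type. *)
Inductive sorted_eq : relation (term oc tc) :=
| sorted_eq_obj t u : oeq t u -> sorted_eq (TmObj t) (TmObj u)
| sorted_eq_ty U V : teq U V -> sorted_eq (TmTy U) (TmTy V).

Lemma obeta_eq_oeq t u : obeta_eq t u -> oeq t u.
Proof. apply clos_rst_map with (f := fun t => t);
  intros; apply rst_step; auto. Qed.

Lemma tbeta_eq_teq U V : tbeta_eq U V -> teq U V.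
Proof. apply clos_rst_map with (f := fun t => t);
  intros; apply rst_step; auto. Qed.

Definition root_step (D : ctx) (T T' : tm) : Prop :=
  exists r s, HRS_beta_gamma G r /\ (forall x, lnf sig D (hctx r x) (s x)) /\
    lnf_of sig D base (hsubst s (hlhs r)) T /\ lnf_of sig D base (hsubst s (hrhs r)) T'.

Lemma lnf_of_unique D a (t u w : tm) :
  lnf_of sig D a t u -> betaeta_eq t w -> lnf sig D a w -> u = w.
Proof.
intros [_ [E L]] E' L'; eapply lnf_unique; eauto. eapply rst_trans; [apply rst_sym|]; eauto.
Qed.

Lemma orule_root u v D s T T' q : In (RuleObj u v) G -> base_ctx D ->
  (forall x, lnf sig D (hctx (enc_orule u v) x) (s x)) ->
  lnf_of sig D base (hsubst s (oencV vempty u)) T ->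
  lnf_of sig D base (hsubst s (oencV vempty v)) T' ->
  T = enc q -> exists q', T' = enc q' /\ sorted_eq q q'.
Proof.
intros HI HD Hs HT HT' E; destruct (HG _ HI) as [[A PA] [FV UN]].
assert (AR := uniform_arity _ _ FV UN).
destruct (proj1 pattern_match _ _ _ PA D s 0) as [w [A1 [B1 C1]]].
{ split; [|split; [|split]]; auto; try discriminate.
  intros x n Hx _. rewrite (AR x n) by (apply in_app_iff; auto). apply Hs. }
(* Uniqueness of long normal forms identifies the term computed along the pattern with the given
   redex, which is an encoding. *)
assert (w = T) by (symmetry; eapply lnf_of_unique; eauto; constructor; auto); subst w.
destruct (C1 q E) as [[t ->] REP]; subst T.
destruct (@finite_choice ob (fun x o => lam_rep (arity (oocc 0 0 u) x) o (s x)) (Var 0) (ofv u))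
  as [sg Hsg].
{ intros x Hx; apply arity_In in Hx; apply (REP _ _ Hx eq_refl). }
assert (Hsg' : forall x n, In (x, n) (oocc 0 0 u ++ oocc 0 0 v) -> lam_rep n (sg x) (s x)).
{ intros x n Hx; rewrite (AR _ _ Hx); apply Hsg.
  apply in_app_iff in Hx as [Hx|Hx]; [|apply FV]; apply in_map_iff; exists (x, n); auto. }
destruct (oencV_simulation lam_rep lam_rep_oenc lam_rep_shift lam_rep_app u sg s) as [o [Ao Bo]].
{ intros; apply Hsg', in_app_iff; auto. }
destruct (oencV_simulation lam_rep lam_rep_oenc lam_rep_shift lam_rep_app v sg s) as [o' [Ao' Bo']].
{ intros; apply Hsg', in_app_iff; auto. }
assert (E1 : oenc t = oenc o)
  by (eapply lnf_of_unique; eauto; constructor; auto using oenc_neu).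
assert (E2 : T' = oenc o')
  by (eapply lnf_of_unique; eauto; constructor; auto using oenc_neu).
apply oenc_inj in E1; subst. exists (TmObj o'); split; auto. constructor.
(* One rule step from [osubst sg u] to [osubst sg v], with beta-conversion at both ends. *)
apply rst_trans with (osubst sg u); [apply rst_sym; now apply obeta_eq_oeq|].
apply rst_trans with (osubst sg v); [|now apply obeta_eq_oeq].
apply rst_step; right; apply ostep_root; now constructor.
Qed.

Lemma trule_root u v D s T T' q : In (RuleTy u v) G -> base_ctx D ->
  (forall x, lnf sig D (hctx (enc_trule u v) x) (s x)) ->
  lnf_of sig D base (hsubst s (tencV vempty u)) T ->
  lnf_of sig D base (hsubst s (tencV vempty v)) T' ->
  T = enc q -> exists q', T' = enc q' /\ sorted_eq q q'.
Proof.
intros HI HD Hs HT HT' E; destruct (HG _ HI) as [[A PA] [FV UN]].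
assert (AR := uniform_arity _ _ FV UN).
destruct (type_pattern_match PA (D := D) (s := s)) as [w [A1 [B1 C1]]].
{ split; [|split; [|split]]; auto; try discriminate.
  intros x n Hx _. rewrite (AR x n) by (apply in_app_iff; auto). apply Hs. }
assert (w = T) by (symmetry; eapply lnf_of_unique; eauto; constructor; auto); subst w.
destruct (C1 q E) as [[U ->] REP]; subst T.
destruct (@finite_choice ob (fun x o => lam_rep (arity (tocc 0 u) x) o (s x)) (Var 0) (tfv u))
  as [sg Hsg].
{ intros x Hx; apply arity_In in Hx; apply (REP _ _ Hx eq_refl). }
assert (Hsg' : forall x n, In (x, n) (tocc 0 u ++ tocc 0 v) -> lam_rep n (sg x) (s x)).
{ intros x n Hx; rewrite (AR _ _ Hx); apply Hsg.
  apply in_app_iff in Hx as [Hx|Hx]; [|apply FV]; apply in_map_iff; exists (x, n); auto. }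
destruct (tencV_simulation lam_rep lam_rep_oenc lam_rep_shift lam_rep_app u sg s) as [W [Ao Bo]].
{ intros; apply Hsg', in_app_iff; auto. }
destruct (tencV_simulation lam_rep lam_rep_oenc lam_rep_shift lam_rep_app v sg s) as [W' [Ao' Bo']].
{ intros; apply Hsg', in_app_iff; auto. }
assert (E1 : tenc U = tenc W)
  by (eapply lnf_of_unique; eauto; constructor; auto using tenc_neu).
assert (E2 : T' = tenc W')
  by (eapply lnf_of_unique; eauto; constructor; auto using tenc_neu).
apply tenc_inj in E1; subst. exists (TmTy W'); split; auto. constructor.
apply rst_trans with (tsubst sg u); [apply rst_sym; now apply tbeta_eq_teq|].
apply rst_trans with (tsubst sg v); [|now apply tbeta_eq_teq].
apply rst_step; right; apply tstep_root; now constructor.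
Qed.

Lemma lnf_base_inv D (T : tm) : lnf sig D base T -> neu sig D base T.
Proof. inversion 1; auto. Qed.

Lemma lnf_arr_inv D a b (T : tm) :
  lnf sig D (arr a b) T -> exists t, T = HLam t /\ lnf sig (scons a D) b t.
Proof. inversion 1; eauto. Qed.

(** With [Y] mapped to [HLam b], the instance of the left-hand side of the HRS beta rule still
    contains the redex [Y(x)], which contracts to [b]. *)
Lemma betaeta_beta_lhs (T1 T2 b : tm) :
  betaeta_eq (happ (hlam T1 (HApp (hren S (HLam b)) (HVar 0))) T2) (happ (hlam T1 b) T2).
Proof.
apply betaeta_bin; [|apply rst_refl]. apply betaeta_bin; [apply rst_refl|].
apply betaeta_lam. rewrite <- (hsubst_var0_upren b) at 2. apply betaeta_beta.
Qed.

Lemma beta_root D s T T' q : base_ctx D ->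
  (forall x, lnf sig D (hctx (beta_rule oc tc) x) (s x)) ->
  lnf_of sig D base (hsubst s (hlhs (beta_rule oc tc))) T ->
  lnf_of sig D base (hsubst s (hrhs (beta_rule oc tc))) T' ->
  T = enc q -> exists q', T' = enc q' /\ sorted_eq q q'.
Proof.
intros HD Hs HT HT' E. simpl in HT, HT'.
assert (H0 := Hs 0); assert (H1 := Hs 1); assert (H2 := Hs 2); simpl in H0, H1, H2.
apply lnf_base_inv in H0, H2; apply lnf_arr_inv in H1 as [b [E1 Hb]].
apply lnf_base_inv in Hb. rewrite E1 in HT, HT'; subst T.
assert (ET : enc q = happ (hlam (s 0) b) (s 2)).
{ eapply lnf_of_unique; [exact HT|apply betaeta_beta_lhs|].
  constructor; apply neu_happ; auto; apply neu_hlam; auto. }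
assert (ET' : forall w, hsubst (scons (s 2) HVar) b = w -> neu sig D base w -> T' = w).
{ intros w <- Hw; eapply lnf_of_unique; [exact HT'|apply betaeta_beta|constructor; auto]. }
(* An encoding with [app] at the root and [lam] in its function part comes from a source beta-redex,
   either of objects or of types. *)
destruct q as [t|U|K|]; simpl in ET.
- destruct t as [| |t v|]; try discriminate. destruct t as [| | |U t]; try discriminate.
  inversion ET as [[F0 F1 F2]]. rewrite <- F1, <- F2 in ET'.
  exists (TmObj (osubst (scons v Var) t)); split.
  + apply ET'; [apply oenc_beta|now apply oenc_neu].
  + constructor; apply rst_step; left; apply ostep_root; constructor.
- destruct U as [|U v| |]; try discriminate. destruct U as [| |U V|]; try discriminate.
  inversion ET as [[F0 F1 F2]]. rewrite <- F1, <- F2 in ET'.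
  exists (TmTy (tsubst (scons v Var) V)); split.
  + apply ET'; [apply tenc_beta|now apply tenc_neu].
  + constructor; apply rst_step; left; apply tstep_root; constructor.
- destruct K; discriminate.
- discriminate.
Qed.

Lemma root_step_enc D q T' : base_ctx D -> root_step D (enc q) T' ->
  exists q', T' = enc q' /\ sorted_eq q q'.
Proof.
intros HD [r [s [Hr [Hs [HT HT']]]]]; destruct Hr.
- eapply beta_root; eauto.
- eapply orule_root; eauto.
- eapply trule_root; eauto.
Qed.

Lemma root_step_oenc D t T' : base_ctx D -> root_step D (oenc t) T' ->
  exists t', T' = oenc t' /\ oeq t t'.
Proof.
intros HD H; destruct (@root_step_enc D (TmObj t) T' HD H) as [q' [-> S]].
inversion S as [? u E|]; exists u; auto.
Qed.

Lemma root_step_tenc D U T' : base_ctx D -> root_step D (tenc U) T' ->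
  exists U', T' = tenc U' /\ teq U U'.
Proof.
intros HD H; destruct (@root_step_enc D (TmTy U) T' HD H) as [q' [-> S]].
inversion S as [|? V E]; exists V; auto.
Qed.

(** Root rewriting happens at base type only, so the partial application [HApp (HCst c) T1] can step
    only inside [T1]. *)
Lemma hstep_bin_inv D c a b (T1 T2 T' : tm) :
  sig c = arr a (arr b base) -> step_in D base (HApp (HApp (HCst c) T1) T2) T' ->
  root_step D (HApp (HApp (HCst c) T1) T2) T' \/
  (exists T1', T' = HApp (HApp (HCst c) T1') T2 /\ step_in D a T1 T1') \/
  (exists T2', T' = HApp (HApp (HCst c) T1) T2' /\ step_in D b T2 T2').
Proof.
intros E H; inversion H; subst.
- left; exists r, s; auto.
- right; left. match goal with H : step_in _ (arr _ _) _ _ |- _ => inversion H; subst end.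
  + match goal with H : step_in _ _ (HCst c) _ |- _ => inversion H end.
  + eexists; split; [reflexivity|].
    match goal with H : neu _ _ _ (HCst c) |- _ => inversion H; congruence end.
- right; right. eexists; split; [reflexivity|].
  match goal with H : neu _ _ _ (HApp _ _) |- _ => inversion H; subst end.
  match goal with H : neu _ _ _ (HCst c) |- _ => inversion H; congruence end.
Qed.

Lemma hstep_lam_inv D a b (T T' : tm) :
  step_in D (arr a b) (HLam T) T' -> exists T1, T' = HLam T1 /\ step_in (scons a D) b T T1.
Proof. intros H; inversion H; subst; eauto. Qed.

Lemma hstep_atom_inv D (T T' : tm) : step_in D base T T' ->
  match T with HVar _ | HCst _ => root_step D T T' | _ => True end.
Proof. intros H; inversion H; subst; auto. destruct T; auto; exists r, s; auto. Qed.

(** Encodings are built from constants and variables of base type, so a step acts at the root or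
    inside the encoding of an immediate subterm. Every binder crossed has type [base], so the
    context remains a [base_ctx]. *)
Lemma hstep_enc :
  (forall (t : ob) D T', base_ctx D -> step_in D base (oenc t) T' ->
    exists t', T' = oenc t' /\ oeq t t') /\
  (forall (U : tp) D T', base_ctx D -> step_in D base (tenc U) T' ->
    exists U', T' = tenc U' /\ teq U U').
Proof.
apply (@obj_ty_ind oc tc
  (fun t => forall D T', base_ctx D -> step_in D base (oenc t) T' ->
    exists t', T' = oenc t' /\ oeq t t')
  (fun U => forall D T', base_ctx D -> step_in D base (tenc U) T' ->
    exists U', T' = tenc U' /\ teq U U')).
- intros x D T' HD H; apply root_step_oenc with D; auto. exact (hstep_atom_inv H).
- intros c D T' HD H; apply root_step_oenc with D; auto. exact (hstep_atom_inv H).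
- intros t IHt u IHu D T' HD H; eapply hstep_bin_inv in H; [|reflexivity].
  destruct H as [H|[[T1 [-> H]]|[T2 [-> H]]]].
  + now apply root_step_oenc with D.
  + destruct (IHt _ _ HD H) as [t' [-> E]]; exists (App t' u); split; auto.
    revert E; apply clos_rst_map with (f := fun t => App t u).
    intros x y [S|S]; apply rst_step; [left|right]; now apply ostep_appl.
  + destruct (IHu _ _ HD H) as [u' [-> E]]; exists (App t u'); split; auto.
    revert E; apply clos_rst_map with (f := fun u => App t u).
    intros x y [S|S]; apply rst_step; [left|right]; now apply ostep_appr.
- intros U IHU t IHt D T' HD H; eapply hstep_bin_inv in H; [|reflexivity].
  destruct H as [H|[[T1 [-> H]]|[T2 [-> H]]]].
  + now apply root_step_oenc with D.
  + destruct (IHU _ _ HD H) as [U' [-> E]]; exists (Lam U' t); split; auto.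
    revert E; apply clos_rst_map with (f := fun U => Lam U t).
    intros x y [S|S]; apply rst_step; [left|right]; now apply ostep_laml.
  + apply hstep_lam_inv in H as [T1 [-> H]].
    destruct (IHt _ _ (base_ctx_scons HD) H) as [t' [-> E]]; exists (Lam U t'); split; auto.
    revert E; apply clos_rst_map with (f := fun t => Lam U t).
    intros x y [S|S]; apply rst_step; [left|right]; now apply ostep_lamr.
- intros C D T' HD H; apply root_step_tenc with D; auto. exact (hstep_atom_inv H).
- intros U IHU t IHt D T' HD H; eapply hstep_bin_inv in H; [|reflexivity].
  destruct H as [H|[[T1 [-> H]]|[T2 [-> H]]]].
  + now apply root_step_tenc with D.
  + destruct (IHU _ _ HD H) as [U' [-> E]]; exists (TApp U' t); split; auto.
    revert E; apply clos_rst_map with (f := fun U => TApp U t).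
    intros x y [S|S]; apply rst_step; [left|right]; now apply tstep_appl.
  + destruct (IHt _ _ HD H) as [t' [-> E]]; exists (TApp U t'); split; auto.
    revert E; apply clos_rst_map with (f := fun t => TApp U t).
    intros x y [S|S]; apply rst_step; [left|right]; now apply tstep_appr.
- intros U IHU V IHV D T' HD H; eapply hstep_bin_inv in H; [|reflexivity].
  destruct H as [H|[[T1 [-> H]]|[T2 [-> H]]]].
  + now apply root_step_tenc with D.
  + destruct (IHU _ _ HD H) as [U' [-> E]]; exists (TLam U' V); split; auto.
    revert E; apply clos_rst_map with (f := fun U => TLam U V).
    intros x y [S|S]; apply rst_step; [left|right]; now apply tstep_laml.
  + apply hstep_lam_inv in H as [T1 [-> H]].
    destruct (IHV _ _ (base_ctx_scons HD) H) as [V' [-> E]]; exists (TLam U V'); split; auto.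
    revert E; apply clos_rst_map with (f := fun V => TLam U V).
    intros x y [S|S]; apply rst_step; [left|right]; now apply tstep_lamr.
- intros U IHU V IHV D T' HD H; eapply hstep_bin_inv in H; [|reflexivity].
  destruct H as [H|[[T1 [-> H]]|[T2 [-> H]]]].
  + now apply root_step_tenc with D.
  + destruct (IHU _ _ HD H) as [U' [-> E]]; exists (TPi U' V); split; auto.
    revert E; apply clos_rst_map with (f := fun U => TPi U V).
    intros x y [S|S]; apply rst_step; [left|right]; now apply tstep_pil.
  + apply hstep_lam_inv in H as [T1 [-> H]].
    destruct (IHV _ _ (base_ctx_scons HD) H) as [V' [-> E]]; exists (TPi U V'); split; auto.
    revert E; apply clos_rst_map with (f := fun V => TPi U V).
    intros x y [S|S]; apply rst_step; [left|right]; now apply tstep_pir.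
Qed.

Lemma hstep_kenc (K : kind oc tc) D T' : base_ctx D -> step_in D base (kenc K) T' ->
  exists K', T' = kenc K' /\ keq K K'.
Proof.
(* A root step would make the kind an object or a type by [sorted_eq]. *)
assert (R : forall K D T', base_ctx D -> ~ root_step D (kenc K) T').
{ clear K D T'; intros K D T' HD H.
  destruct (@root_step_enc D (TmKind K) T' HD H) as [q' [_ S]]; inversion S. }
revert D T'; induction K as [|U K IHK]; intros D T' HD H.
- destruct (R KType D T' HD). exact (hstep_atom_inv H).
- eapply hstep_bin_inv in H; [|reflexivity].
  destruct H as [H|[[T1 [-> H]]|[T2 [-> H]]]].
  + now destruct (R (KPi U K) D T' HD).
  + destruct (proj2 hstep_enc _ _ _ HD H) as [U' [-> E]]; exists (KPi U' K); split; auto.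
    revert E; apply clos_rst_map with (f := fun U => KPi U K).
    intros x y [S|S]; apply rst_step; [left|right]; now apply kstep_pil.
  + apply hstep_lam_inv in H as [T1 [-> H]].
    destruct (IHK _ _ (base_ctx_scons HD) H) as [K' [-> E]]; exists (KPi U K'); split; auto.
    revert E; apply clos_rst_map with (f := fun K => KPi U K).
    intros x y [S|S]; apply rst_step; [left|right]; now apply kstep_pir.
Qed.

Lemma beta_gamma_beta_conv t1 t2 : beta_gamma_beta G t1 t2 -> conv_beta_gamma G t1 t2.
Proof.
unfold beta_gamma_beta; intros H.
assert (HD : base_ctx (fun _ => base)) by (intros x; reflexivity).
destruct t1 as [t|U|K|]; simpl in H.
- destruct (proj1 hstep_enc _ _ _ HD H) as [t' [E S]].
  (* Only the encoding of [t2] is known so far; injectivity also fixes its syntactic class. *)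
  apply (@enc_inj t2 (TmObj t')) in E as ->.
  revert S; apply clos_rst_map; intros x y [S|S]; apply rst_step; [left|right]; now constructor.
- destruct (proj2 hstep_enc _ _ _ HD H) as [U' [E S]].
  apply (@enc_inj t2 (TmTy U')) in E as ->.
  revert S; apply clos_rst_map; intros x y [S|S]; apply rst_step; [left|right]; now constructor.
- destruct (hstep_kenc _ HD H) as [K' [E S]].
  apply (@enc_inj t2 (TmKind K')) in E as ->.
  revert S; apply clos_rst_map; intros x y [S|S]; apply rst_step; [left|right]; now constructor.
- apply hstep_atom_inv in H. destruct (@root_step_enc _ TmKIND _ HD H) as [q' [_ S]]; inversion S.
Qed.

(** * From beta and the rules to the HRS *)

(** Steps are required in every base context so that conversions pass under binders: [scons base D]
    agrees with the constant context pointwise but not definitionally. *)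
Definition hconv (X : Type) (e : X -> tm) : relation X :=
  clos_refl_sym_trans X (fun t u => forall D, base_ctx D -> step_in D base (e t) (e u)).

Lemma hstep_bin_l D c a b (T1 T1' T2 : tm) :
  sig c = arr a (arr b base) -> lnf sig D a T1 -> lnf sig D b T2 -> step_in D a T1 T1' ->
  step_in D base (HApp (HApp (HCst c) T1) T2) (HApp (HApp (HCst c) T1') T2).
Proof.
intros E L1 L2 H. assert (C : neu sig D (arr a (arr b base)) (HCst c))
  by (rewrite <- E; constructor).
apply hstep_appl with b; auto.
- apply neu_app with a; auto.
- apply hstep_appr with a; auto.
Qed.

Lemma hstep_bin_r D c a b (T1 T2 T2' : tm) :
  sig c = arr a (arr b base) -> lnf sig D a T1 -> step_in D b T2 T2' ->
  step_in D base (HApp (HApp (HCst c) T1) T2) (HApp (HApp (HCst c) T1) T2').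
Proof.
intros E L H. apply hstep_appr with b; auto. apply neu_app with a; auto.
rewrite <- E; constructor.
Qed.

Section Compatible.

Variables (Ro : relation ob) (Rt : relation tp).
Hypothesis Ro_hconv : forall t u, Ro t u -> hconv (@oenc oc tc) t u.
Hypothesis Rt_hconv : forall U V, Rt U V -> hconv (@tenc oc tc) U V.

Scheme ostep_mut_ind := Induction for ostep Sort Prop
with tstep_mut_ind := Induction for tstep Sort Prop.
Combined Scheme ostep_tstep_ind from ostep_mut_ind, tstep_mut_ind.

Ltac hconv_bin F :=
  match goal with H : hconv _ _ _ |- _ => revert H end;
  apply clos_rst_map with (f := F); intros x y H; apply rst_step; intros D HD;
  simpl; unfold happ, hlam, hpi;
  first [ eapply hstep_bin_l; [reflexivity| | |now apply H]
        | eapply hstep_bin_r; [reflexivity| |first [now apply H|apply hstep_lam, H; auto]] ];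
  repeat constructor; auto using oenc_neu, tenc_neu, kenc_neu.

(** Arbitrary root relations are allowed because the lifting is used twice, for beta and for the
    rules, and the treatment of a rule instance already relies on the beta case. *)
Lemma ostep_tstep_hconv :
  (forall t u, ostep Ro Rt t u -> hconv (@oenc oc tc) t u) /\
  (forall U V, tstep Ro Rt U V -> hconv (@tenc oc tc) U V).
Proof.
apply (@ostep_tstep_ind oc tc Ro Rt (fun t u _ => hconv (@oenc oc tc) t u)
  (fun U V _ => hconv (@tenc oc tc) U V)); auto.
- intros t t' u _ IH; hconv_bin (fun t : ob => App t u).
- intros t u u' _ IH; hconv_bin (fun u : ob => App t u).
- intros U U' t _ IH; hconv_bin (fun U : tp => Lam U t).
- intros U t t' _ IH; hconv_bin (fun t : ob => Lam U t).
- intros U U' t _ IH; hconv_bin (fun U : tp => TApp U t).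
- intros U t t' _ IH; hconv_bin (fun t : ob => TApp U t).
- intros U U' V _ IH; hconv_bin (fun U : tp => TLam U V).
- intros U V V' _ IH; hconv_bin (fun V : tp => TLam U V).
- intros U U' V _ IH; hconv_bin (fun U : tp => TPi U V).
- intros U V V' _ IH; hconv_bin (fun V : tp => TPi U V).
Qed.

Lemma kstep_hconv K L : kstep Ro Rt K L -> hconv (@kenc oc tc) K L.
Proof.
induction 1 as [U U' K H|U K K' _ IH].
- apply (proj2 ostep_tstep_hconv) in H. hconv_bin (fun U : tp => KPi U K).
- hconv_bin (fun K : kind oc tc => KPi U K).
Qed.

Lemma step_conv_beta_gamma_beta t u : step Ro Rt t u -> conv_beta_gamma_beta G t u.
Proof.
assert (HD : base_ctx (fun _ => base)) by (intros x; reflexivity).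
destruct 1 as [t t' H|U U' H|K K' H].
- apply (proj1 ostep_tstep_hconv) in H. revert H; apply clos_rst_map with (f := @TmObj oc tc).
  intros x y H; apply rst_step, H, HD.
- apply (proj2 ostep_tstep_hconv) in H. revert H; apply clos_rst_map with (f := @TmTy oc tc).
  intros x y H; apply rst_step, H, HD.
- apply kstep_hconv in H. revert H; apply clos_rst_map with (f := @TmKind oc tc).
  intros x y H; apply rst_step, H, HD.
Qed.

End Compatible.

(** Both sides of a well-formed rule have base type, so their instances are typable. What remains of
    [lnf_of] is conversion and normality. *)
Lemma hstep_instance r D s T T' :
  HRS_beta_gamma G r -> (forall x, lnf sig D (hctx r x) (s x)) ->
  betaeta_eq (hsubst s (hlhs r)) T -> neu sig D base T ->
  betaeta_eq (hsubst s (hrhs r)) T' -> neu sig D base T' -> step_in D base T T'.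
Proof.
intros Hr Hs E N E' N'.
destruct (HRS_beta_gamma_wf HG Hr) as [L [L' _]].
assert (Ht : forall T, lnf sig (hctx r) base T -> has_type sig D base (hsubst s T)).
{ intros T0 L0; apply has_type_hsubst with (hctx r); [|intros x];
    now apply (proj1 (lnf_has_type sig)). }
apply hstep_root with r s; auto; (split; [|split]); auto; now constructor.
Qed.

Lemma hstep_beta D T1 b T2 w :
  neu sig D base T1 -> neu sig (scons base D) base b -> neu sig D base T2 ->
  hsubst (scons T2 HVar) b = w -> neu sig D base w ->
  step_in D base (happ (hlam T1 b) T2) w.
Proof.
intros N1 Nb N2 <- Nw.
(* [X], [Y], [Z] go to [T1], [HLam b], [T2]. A substitution must be well typed at every index, and
   [T2] also serves the indices beyond 2, which have base type. *)
apply hstep_instance with (beta_rule oc tc) (scons T1 (scons (HLam b) (fun _ => T2))).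
- constructor.
- intros [|[|x]]; simpl; repeat constructor; auto.
- apply betaeta_beta_lhs.
- auto using neu_happ, neu_hlam.
- apply betaeta_beta.
- auto.
Qed.

Lemma obeta_hconv t u : obeta t u -> hconv (@oenc oc tc) t u.
Proof.
destruct 1; apply rst_step; intros D HD.
apply hstep_beta; auto using oenc_neu, tenc_neu, oenc_beta.
Qed.

Lemma tbeta_hconv U V : tbeta U V -> hconv (@tenc oc tc) U V.
Proof.
destruct 1; apply rst_step; intros D HD.
apply hstep_beta; auto using oenc_neu, tenc_neu, tenc_beta.
Qed.

Lemma obeta_eq_hconv t u : obeta_eq t u -> hconv (@oenc oc tc) t u.
Proof.
apply clos_rst_map with (f := fun t => t).
apply (ostep_tstep_hconv _ _ obeta_hconv tbeta_hconv).
Qed.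

Lemma tbeta_eq_hconv U V : tbeta_eq U V -> hconv (@tenc oc tc) U V.
Proof.
apply clos_rst_map with (f := fun t => t).
apply (ostep_tstep_hconv _ _ obeta_hconv tbeta_hconv).
Qed.

Lemma orule_hconv t t' : orule G t t' -> hconv (@oenc oc tc) t t'.
Proof.
destruct 1 as [u v sg HI]; destruct (HG _ HI) as [_ [FV UN]].
assert (AR := uniform_arity _ _ FV UN).
(* Variables absent from [u] have the dummy arity 0 and keep the plain encoding of [sg x], so [s] is
   well typed at every index. *)
pose (s := fun x => eta_expand (arity (oocc 0 0 u) x) (oenc (sg x))).
destruct (oencV_simulation eta_rep eta_rep_0 eta_rep_shift eta_rep_app u sg s) as [o [A B]].
{ intros x n Hx; rewrite (AR x n) by (apply in_app_iff; auto); reflexivity. }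
destruct (oencV_simulation eta_rep eta_rep_0 eta_rep_shift eta_rep_app v sg s) as [o' [A' B']].
{ intros x n Hx; rewrite (AR x n) by (apply in_app_iff; auto); reflexivity. }
(* The HRS step links [o] to [o'], the beta-converted forms of [osubst sg u] and [osubst sg v]; HRS
   beta steps bridge the rest. *)
apply rst_trans with o; [now apply obeta_eq_hconv|].
apply rst_trans with o'; [|apply rst_sym; now apply obeta_eq_hconv].
apply rst_step; intros D HD. apply hstep_instance with (enc_orule u v) s; auto using oenc_neu.
- now constructor.
- intros x; apply eta_expand_lnf; auto using oenc_neu.
Qed.

Lemma trule_hconv U U' : trule G U U' -> hconv (@tenc oc tc) U U'.
Proof.
destruct 1 as [u v sg HI]; destruct (HG _ HI) as [_ [FV UN]].
assert (AR := uniform_arity _ _ FV UN).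
pose (s := fun x => eta_expand (arity (tocc 0 u) x) (oenc (sg x))).
destruct (tencV_simulation eta_rep eta_rep_0 eta_rep_shift eta_rep_app u sg s) as [W [A B]].
{ intros x n Hx; rewrite (AR x n) by (apply in_app_iff; auto); reflexivity. }
destruct (tencV_simulation eta_rep eta_rep_0 eta_rep_shift eta_rep_app v sg s) as [W' [A' B']].
{ intros x n Hx; rewrite (AR x n) by (apply in_app_iff; auto); reflexivity. }
apply rst_trans with W; [now apply tbeta_eq_hconv|].
apply rst_trans with W'; [|apply rst_sym; now apply tbeta_eq_hconv].
apply rst_step; intros D HD. apply hstep_instance with (enc_trule u v) s; auto using tenc_neu.
- now constructor.
- intros x; apply eta_expand_lnf; auto using oenc_neu.
Qed.

End Encoding.

Theorem mainTheorem9 (oc tc : Type) (G : gctx oc tc)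
  (HG : forall e : entry oc tc, In e G -> encodable e) :
  forall t1 t2 : term oc tc,
    conv_beta_gamma_beta G t1 t2 <-> conv_beta_gamma G t1 t2.
Proof.
intros t1 t2; split; apply clos_rst_map with (f := fun t => t).
- intros x y; now apply beta_gamma_beta_conv.
- intros x y [H|H].
  + eapply step_conv_beta_gamma_beta; [| |exact H]; auto using obeta_hconv, tbeta_hconv.
  + eapply step_conv_beta_gamma_beta; [| |exact H]; auto using orule_hconv, trule_hconv.
Qed.
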